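(* Let $d\ge 1$, let $B_1\subset\mathbb{R}^d$ be the open unit ball, and let $(a^{ij}(x))_{i,j=1}^d$, $x\in B_1$, be a symmetric matrix-valued map such that: (i) there are constants $0<\lambda\le\Lambda$ with $\lambda\,\mathrm{Id}\le (a^{ij}(x))_{i,j=1}^d\le\Lambda\,\mathrm{Id}$ for every $x\in B_1$; (ii) there is $\alpha\in(0,1)$ such that $a^{ij}\in\mathcal{C}^{\alpha}_{loc}(B_1)$ for every $1\le i,j\le d$. Let $u\in L^1_{loc}(B_1)$ be a weak solution to $$\partial^2_{x_ix_j}\left(a^{ij}(x)u(x)\right)=0\quad\text{in }B_1,$$ and let $x_0\in S_0[u]:=\{x\in B_1: u(x)=0\}$. Then $u$ is of class $\mathcal{C}^{1^-}$ at $x_0$, and there exists a constant $C>0$ such that, for all sufficiently small $r>0$ (that is, for all $0<r<r_0$ with some $r_0>0$), $$\sup_{x\in B_r(x_0)}|u(x_0)-u(x)|\le C r^{\alpha^*}$$ for every $\alpha^*\in(0,1)$.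
   Context: Repeated indices $i,j$ are summed from $1$ to $d$. $B_r(x_0)$ is the open ball of radius $r$ centered at $x_0$. A function $u\in L^1_{loc}(B_1)$ is a weak solution to $\partial^2_{x_ix_j}(a^{ij}(x)u(x))=0$ in $B_1$ if $\int_{B_1}a^{ij}(x)u(x)\,\phi_{x_ix_j}(x)\,dx=0$ for every $\phi\in\mathcal{C}^2_c(B_1)$. Convention: under these hypotheses every weak solution coincides almost everywhere with a continuous function (a known fact), and $u$ is always identified with this continuous representative; in particular the values $u(x)$ and the set $S_0[u]$ refer to it. ''Of class $\mathcal{C}^{1^-}$ at $x_0$'' means of class $\mathcal{C}^{\alpha^*}$ at the point $x_0$ for every $\alpha^*\in(0,1)$, in the pointwise sense expressed by the displayed estimate. *)

(* Defs.v *)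
From HB Require Import structures.
From mathcomp Require Import all_boot all_order all_algebra.
From mathcomp Require Import all_classical all_reals all_analysis measurable_realfun.

Set Implicit Arguments.
Unset Strict Implicit.
Unset Printing Implicit Defensive.

Import Order.TTheory GRing.Theory Num.Theory.
Import numFieldNormedType.Exports.

Local Open Scope classical_set_scope.
Local Open Scope ring_scope.

(* The library puts a sigma-algebra on n.-tuple T but not on 'rV[T]_n, and has
   Lebesgue measure on R only.  Row vectors are needed because they carry the
   normed-module structure used for partial derivatives. *)

Definition measure_row_display : measure_display -> measure_display.
Proof. exact. Qed.

Section measurable_row.
Context {disp} {T : measurableType disp}.
Variable n : nat.

Let coors : 'I_n -> 'rV[T]_n -> T := fun i x => x ord0 i.

Let row_set0 : g_sigma_preimage coors set0.
Proof. exact: sigma_algebra0. Qed.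

Let row_setC A : g_sigma_preimage coors A -> g_sigma_preimage coors (~` A).
Proof. exact: sigma_algebraC. Qed.

Let row_bigcup (F : (set _)^nat) : (forall i, g_sigma_preimage coors (F i)) ->
  g_sigma_preimage coors (\bigcup_i (F i)).
Proof. exact: sigma_algebra_bigcup. Qed.

HB.instance Definition _ := @isMeasurable.Build (measure_row_display disp)
  'rV[T]_n (g_sigma_preimage coors) row_set0 row_setC row_bigcup.

End measurable_row.

(* d-dimensional Lebesgue measure (on Borel sets), by slicing along the first
   coordinate; lebesgue_rV_box gives its value on boxes. *)
Fixpoint lebesgue_rV (R : realType) (n : nat) : set 'rV[R]_n -> \bar R :=
  match n return set 'rV[R]_n -> \bar R with
  | 0 => fun A => \d_(0 : 'rV[R]_0) A
  | m.+1 => fun A => (\int[lebesgue_measure]_t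
      lebesgue_rV [set y : 'rV[R]_m | A (row_mx (t%:M : 'rV[R]_1) y)])%E
  end.

Lemma measurable_coord d (T : measurableType d) n (i : 'I_n) :
  measurable_fun [set: 'rV[T]_n] (fun x => x ord0 i).
Proof.
move=> _ Y mY; rewrite setTI; apply: sub_sigma_algebra => /=.
rewrite -bigcup_seq/=; exists i => /=; first by rewrite mem_index_enum.
by exists Y => //; rewrite setTI.
Qed.

Lemma measurable_fun_row d d' (T : measurableType d) (T' : measurableType d') n
    (f : T -> 'rV[T']_n) :
  (forall i, measurable_fun [set: T] (fun t => f t ord0 i)) ->
  measurable_fun [set: T] f.
Proof.
move=> mf; apply: (@measurability _ _ _ _ _ _ (\big[setU/set0]_(i < n)
  preimage_set_system [set: 'rV[T']_n] (fun x => x ord0 i) measurable)) => //.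
move=> _ [B + <-]; rewrite -bigcup_seq => -[i _ [C mC <-]].
by rewrite setTI; exact: mf.
Qed.

Section lebesgue_rV.
Context {R : realType}.
Local Open Scope ereal_scope.

Let cons_rV n (p : R * 'rV[R]_n) : 'rV[R]_n.+1 :=
  row_mx (p.1%:M : 'rV[R]_1) p.2.

Let measurable_cons_rV n : measurable_fun setT (@cons_rV n).
Proof.
apply: measurable_fun_row => i; case: (unliftP ord0 i) => [j|] ->.
  rewrite [X in measurable_fun _ X](_ : _ = (fun x : 'rV[R]_n => x ord0 j) \o snd).
    by apply: measurableT_comp => //; exact: measurable_coord.
  apply/funext => -[t y] /=; rewrite /cons_rV mxE; case: splitP => [k|k] /=.
    by rewrite ord1.
  by move=> [jk]; congr (y _ _); apply/val_inj.
rewrite [X in measurable_fun _ X](_ : _ = fst) //.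
apply/funext => -[t y] /=; rewrite /cons_rV mxE; case: splitP => [k|k] //=.
by rewrite ord1 mxE eqxx mulr1n.
Qed.

Let uncons_rV n (x : 'rV[R]_n.+1) : R * 'rV[R]_n :=
  (x ord0 ord0, \row_i x ord0 (lift ord0 i)).

Let measurable_uncons_rV n : measurable_fun setT (@uncons_rV n).
Proof.
apply/measurable_fun_pairP; split; first exact: measurable_coord.
apply: measurable_fun_row => i; rewrite [X in measurable_fun _ X](_ : _ =
  (fun x : 'rV[R]_n.+1 => x ord0 (lift ord0 i))).
  exact: measurable_coord.
by apply/funext => x /=; rewrite mxE.
Qed.

Let cons_rVK n : cancel (@cons_rV n) (@uncons_rV n).
Proof.
move=> [t y]; congr pair.
  rewrite /cons_rV mxE; case: splitP => [k|k] //=.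
  by rewrite ord1 mxE eqxx mulr1n.
apply/rowP => i; rewrite !mxE; case: splitP => [k|k] /=.
  by rewrite ord1.
by move=> [jk]; congr (y _ _); apply/val_inj.
Qed.

Let lebesgue_rVS n A :
  @lebesgue_rV R n.+1 A =
  (lebesgue_measure \x @lebesgue_rV R n) (@cons_rV n @^-1` A).
Proof.
rewrite /product_measure1 /=; apply: eq_integral => t _; congr (lebesgue_rV _).
by apply/seteqP; split => y; [move=> ?; apply/xsectionP|move/xsectionP].
Qed.

Section lebesgue_cons.
Variables (n : nat) (m : {sigma_finite_measure set 'rV[R]_n -> \bar R}).

Let nu : set 'rV[R]_n.+1 -> \bar R :=
  pushforward (lebesgue_measure \x m) (@cons_rV n).

Let mpre A : measurable A -> measurable (@cons_rV n @^-1` A).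
Proof. by move=> mA; rewrite -[X in measurable X]setTI; exact: measurable_cons_rV. Qed.

Let nu0 : nu set0 = 0.
Proof. by rewrite /nu /pushforward preimage_set0 measure0. Qed.

Let nu_ge0 A : 0 <= nu A.
Proof. exact: (measure_ge0 (lebesgue_measure \x m)). Qed.

Let nu_sigma_additive : semi_sigma_additive nu.
Proof.
move=> F mF tF mUF; rewrite /nu /pushforward preimage_bigcup.
apply: measure_semi_sigma_additive.
- by move=> k; exact: mpre.
- apply/trivIsetP => /= i j _ _ ij; rewrite -preimage_setI.
  by move/trivIsetP : tF => /(_ _ _ _ _ ij) ->//; rewrite preimage_set0.
- by rewrite -preimage_bigcup; exact: mpre.
Qed.

HB.instance Definition _ := isMeasure.Build _ _ _ nu
  nu0 nu_ge0 nu_sigma_additive.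

Let nu_sigma_finite : sigma_finite setT nu.
Proof.
have /sigma_finiteP[F [TF ndF Foo]] := sigma_finiteT (@lebesgue_measure R).
have /sigma_finiteP[G [TG ndG Goo]] := sigma_finiteT m.
exists (fun k => @uncons_rV n @^-1` (F k `*` G k)).
  apply/seteqP; split => // x _; set p := uncons_rV x.
  have [k _ Fk] : (\bigcup_k F k) p.1 by rewrite -TF.
  have [l _ Gl] : (\bigcup_k G k) p.2 by rewrite -TG.
  exists (maxn k l) => //; split.
  - by move: Fk; exact/subsetPset/ndF/leq_maxl.
  - by move: Gl; exact/subsetPset/ndG/leq_maxr.
move=> k; have [? ?] := Foo k; have [? ?] := Goo k; split.
  rewrite -[X in measurable X]setTI; apply: measurable_uncons_rV => //.
  exact: measurableX.
rewrite /nu /pushforward -comp_preimage.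
rewrite [X in preimage X](_ : _ = id); last exact/funext/cons_rVK.
by rewrite preimage_id product_measure1E// lte_mul_pinfty// ge0_fin_numE.
Qed.

HB.instance Definition _ := Measure_isSigmaFinite.Build _ _ _ nu nu_sigma_finite.

Lemma lebesgue_cons_measure :
  exists p : {sigma_finite_measure set 'rV[R]_n.+1 -> \bar R},
  forall A, p A = (lebesgue_measure \x m) (@cons_rV n @^-1` A).
Proof. by exists nu. Qed.

End lebesgue_cons.

Let lebesgue_rV_sigma_finite_measure n :
  exists m : {sigma_finite_measure set 'rV[R]_n -> \bar R}, @lebesgue_rV R n = m.
Proof.
elim: n => [|n [m mE]]; first by exists (\d_(0%R : 'rV[R]_0)).
have [p pE] := lebesgue_cons_measure m.
by exists p; apply/funext => A; rewrite lebesgue_rVS mE pE.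
Qed.

Let lebesgue_rV0 n : @lebesgue_rV R n set0 = 0.
Proof. by have [m ->] := lebesgue_rV_sigma_finite_measure n; exact: measure0. Qed.

Let lebesgue_rV_ge0 n A : 0 <= @lebesgue_rV R n A.
Proof. by have [m ->] := lebesgue_rV_sigma_finite_measure n; exact: measure_ge0. Qed.

Let lebesgue_rV_sigma_additive n : semi_sigma_additive (@lebesgue_rV R n).
Proof.
have [m ->] := lebesgue_rV_sigma_finite_measure n.
exact: measure_semi_sigma_additive.
Qed.

HB.instance Definition _ n := isMeasure.Build _ _ _ (@lebesgue_rV R n)
  (lebesgue_rV0 n) (@lebesgue_rV_ge0 n) (@lebesgue_rV_sigma_additive n).

Let lebesgue_rV_sigma_finite n : sigma_finite setT (@lebesgue_rV R n).
Proof.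
by have [m ->] := lebesgue_rV_sigma_finite_measure n; exact: sigma_finiteT.
Qed.

HB.instance Definition _ n := Measure_isSigmaFinite.Build _ _ _
  (@lebesgue_rV R n) (lebesgue_rV_sigma_finite n).

Lemma lebesgue_rV_box n (a b : 'rV[R]_n) : (forall i, a ord0 i <= b ord0 i)%R ->
  lebesgue_rV [set x : 'rV[R]_n | forall i, x ord0 i \in `[a ord0 i, b ord0 i]]
  = (\prod_i (b ord0 i - a ord0 i))%:E.
Proof.
elim: n => [|n IH] in a b * => ab.
  by rewrite big_ord0 /= diracE mem_set// => -[].
rewrite big_ord_recl /=.
pose a' := (\row_i a ord0 (lift ord0 i))%R; pose b' := (\row_i b ord0 (lift ord0 i))%R.
transitivity (\int[lebesgue_measure]_t
   ((\prod_i (b' ord0 i - a' ord0 i))%:E *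
    (\1_(`[a ord0 ord0, b ord0 ord0]%classic : set R) t)%:E)).
  apply: eq_integral => t _.
  have a'b' i : (a' ord0 i <= b' ord0 i)%R by rewrite !mxE.
  have row0 (y : 'rV[R]_n) : row_mx (t%:M : 'rV[R]_1) y ord0 ord0 = t.
    rewrite mxE; case: splitP => [k|k] //= _.
    by rewrite ord1 mxE (ord1 k) eqxx mulr1n.
  have rowS (y : 'rV[R]_n) i :
      row_mx (t%:M : 'rV[R]_1) y ord0 (lift ord0 i) = y ord0 i.
    rewrite mxE; case: splitP => [k|k] /=; first by rewrite ord1.
    by move=> [jk]; congr (y _ _); apply/val_inj.
  rewrite -IH// indicE; have [tab|tab] := boolP (t \in _).
    rewrite mule1; congr (lebesgue_rV _); apply/seteqP; split => y /= yab i.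
      by have := yab (lift ord0 i); rewrite rowS !mxE.
    case: (unliftP ord0 i) => [j|] ->; last by rewrite row0; rewrite inE in tab.
    by have := yab j; rewrite rowS !mxE.
  rewrite mule0 (_ : [set _ | _] = set0) ?measure0//.
  apply/seteqP; split => // y /= /(_ ord0); rewrite row0 => tab'.
  by move: tab; rewrite notin_setE.
rewrite ge0_integralZl_EFin//=; last 2 first.
- by apply/measurable_EFinP; exact: measurable_indic.
- by apply: prodr_ge0 => i _; rewrite subr_ge0 !mxE.
rewrite integral_indic// setIT.
rewrite [X in _ * X](_ : _ = (b ord0 ord0 - a ord0 ord0)%:E).
  rewrite muleC EFinM; congr (_ * _)%E.
  by congr EFin; apply: eq_bigr => i _; rewrite !mxE.
apply: etrans (lebesgue_measure_itv `[a ord0 ord0, b ord0 ord0]) _.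
rewrite /= lte_fin; case: ltgtP (ab ord0) => // -> _.
by rewrite subrr.
Qed.

End lebesgue_rV.

Section double_divergence.
Context {R : realType} {d : nat}.
Implicit Types (x : 'rV[R]_d) (f u : 'rV[R]_d -> R) (a : 'rV[R]_d -> 'M[R]_d).

(* The library norm on 'rV[R]_d is the sup norm (it induces the same topology,
   hence the same compact sets and continuous functions). *)
Definition enorm x : R := Num.sqrt (\sum_i x ord0 i ^+ 2).

Definition eball x (r : R) : set 'rV[R]_d := [set y | enorm (y - x) < r].

Definition B1 : set 'rV[R]_d := eball 0 1.

(* lam Id <= A <= Lam Id in the Loewner order. *)
Definition elliptic (lam Lam : R) (A : 'M[R]_d) : Prop :=
  forall xi : 'rV[R]_d,
    lam * enorm xi ^+ 2 <= \sum_i \sum_j A i j * xi ord0 i * xi ord0 j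
      <= Lam * enorm xi ^+ 2.

Definition holder_loc (alpha : R) (D : set 'rV[R]_d) f : Prop :=
  forall K, compact K -> K `<=` D -> exists C : R,
    forall x y, K x -> K y -> `|f x - f y| <= C * enorm (x - y) `^ alpha.

Definition L1_loc (D : set 'rV[R]_d) f : Prop :=
  measurable_fun D f /\ forall K, compact K -> K `<=` D ->
    (\int[@lebesgue_rV R d]_(x in K) `|f x|%:E < +oo)%E.

Definition partial (i : 'I_d) f : 'rV[R]_d -> R :=
  fun x => 'D_(delta_mx ord0 i) f x.

Definition C2 f : Prop :=
  [/\ continuous f,
      forall i, (forall x, derivable f x (delta_mx ord0 i)) /\
                continuous (partial i f)
    & forall i j, (forall x, derivable (partial i f) x (delta_mx ord0 j)) /\
                  continuous (partial j (partial i f))].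

(* C^2_c(D), each function being extended by zero outside D. *)
Definition C2_c (D : set 'rV[R]_d) f : Prop :=
  C2 f /\ exists K, [/\ compact K, K `<=` D & forall x, ~ K x -> f x = 0].

Definition weak_solution a u : Prop :=
  forall phi, C2_c B1 phi ->
    (\int[@lebesgue_rV R d]_(x in B1)
      (\sum_i \sum_j a x i j * u x * partial j (partial i phi) x)%:E = 0)%E.

Definition S0 u : set 'rV[R]_d := [set x | B1 x /\ u x = 0].

(* Valued in \bar R, because the real-valued sup of an unbounded set is 0. *)
Definition osc_at u x (r : R) : \bar R :=
  ereal_sup [set `|u x - u y|%:E | y in eball x r].

Definition holder_at u x (alpha : R) : Prop :=
  exists C : R, 0 < C /\ exists r0 : R, 0 < r0 /\
    forall r, 0 < r < r0 -> (osc_at u x r <= (C * r `^ alpha)%:E)%E.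

Definition C1minus_at u x : Prop :=
  forall alpha : R, 0 < alpha < 1 -> holder_at u x alpha.

End double_divergence.

(* Main.v *)
Require Import Defs.
From mathcomp Require Import all_boot all_order all_algebra.
From mathcomp Require Import all_classical all_reals all_analysis.
From mathcomp Require Import ring lra measurable_realfun.

(* Let B = (a y)^-1, q(z) = z B z^T and w_t = max(0, t^2 - q(x - y)).  Pointwise,
   a(y) : D^2 (w_t^3) = 24 t^2 w_t - (6 d + 24) w_t^2, so that for
   P_t = t^-(d+4) \int u w_t^2 one has
   6 t^(d+5) P_t' = \int u a(y) : D^2 (w_t^3) = \int u (a(y) - a(x)) : D^2 (w_t^3)
   as soon as u is a weak solution. By Hoelder continuity of a,
   |P_t'| <= C t^(alpha - 1) sup |u|, and letting the radius go to 0 gives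
   u(y) up to a factor bounded away from 0.  No fundamental solution is needed.

   Let now u(x0) = 0 and suppose |u(x)| <= G (|x - x0| + eps) near x0.  Take y with
   |y - x0| = s.  Freezing the coefficients at x0 for both centers, the derivative of the
   difference of P_t centered at y and at x0 gains a factor s / t, and is at most
   C G (s + eps) t^(alpha - 1) for t >= s; integrating from s to a small r0 gives
   |u(y)| <= C s + G (s + eps) / 2.  Hence the best constant G is at most 2 C,
   uniformly in eps, so u is Lipschitz at x0, which is the bound with a constant
   independent of the exponent. *)

Set Implicit Arguments.
Unset Strict Implicit.
Unset Printing Implicit Defensive.

Import Order.TTheory GRing.Theory Num.Theory.
Import numFieldNormedType.Exports.
Local Open Scope classical_set_scope.
Local Open Scope ring_scope.

(** The vanishing of [u] at [x0] is what beats the Hoelder exponent. Moving the centre by s costs a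
    factor s / t in the derivative of the mean; with [|u|] merely bounded one would integrate s
    t^(alpha - 2) from s on and get only order s^alpha. At a zero, [|u|] is of order G (t + eps) on
    the support, and (s / t) (t + eps) <= s + eps for t >= s: the power of t is recovered and
    t^(alpha - 1) is integrable down to 0. Centres are compared only at radii t >= s; below s each
    mean is related to the value of [u] at its own centre, with an error of order G (s + eps)
    s^alpha.

    The cube is the lowest integer power of the truncated paraboloid with a continuous Hessian,
    hence directly admissible as a test function. The shift eps keeps the quotient |u(x)| / (|x -
    x0| + eps) bounded, so that its supremum is finite, and can be absorbed, before any Lipschitz
    bound is known. *)

Section row_bounds.
Context {R : realType} {d : nat}.
Implicit Types (z : 'rV[R]_d) (B : 'M[R]_d).

(** * Sup-norm bounds for quadratic forms and inverse matrices *)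

Lemma coord_norm_le z i : `|z ord0 i| <= `|z|.
Proof.
rewrite /Num.norm/= mx_normrE.
exact: (@le_bigmax _ _ _ _ (fun k : 'I_1 * 'I_d => `|z k.1 k.2|) (ord0, i)).
Qed.

Lemma norm_row_le z c : 0 <= c -> (forall i, `|z ord0 i| <= c) -> `|z| <= c.
Proof.
move=> c0 zc; rewrite /Num.norm/= mx_normrE.
by apply: bigmax_le => // -[i j] _ /=; rewrite (ord1 i).
Qed.

Lemma sum_norm_le (F : 'I_d -> R) c : (forall i, `|F i| <= c) ->
  `|\sum_i F i| <= d%:R * c.
Proof.
move=> Fc; apply: (le_trans (ler_norm_sum _ _ _)).
apply: (le_trans (ler_sum _ (fun i _ => Fc i))).
by rewrite sumr_const card_ord mulr_natl.
Qed.

Lemma sum2_norm_le (F : 'I_d -> 'I_d -> R) c : (forall i j, `|F i j| <= c) ->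
  `|\sum_i \sum_j F i j| <= d%:R ^+ 2 * c.
Proof.
move=> Fc; rewrite expr2 -mulrA; apply: sum_norm_le => i; exact: sum_norm_le.
Qed.

Lemma mulmx_norm_le z B b : 0 <= b -> (forall i j, `|B i j| <= b) ->
  `|z *m B| <= d%:R * b * `|z|.
Proof.
move=> b0 Bb; apply: norm_row_le => [|i]; first by rewrite !mulr_ge0.
rewrite mxE -mulrA; apply: sum_norm_le => j.
by rewrite normrM mulrC ler_pM ?coord_norm_le.
Qed.

Definition dotr z z' : R := \sum_i z ord0 i * z' ord0 i.

Lemma dotr_norm_le z z' : `|dotr z z'| <= d%:R * (`|z| * `|z'|).
Proof. by apply: sum_norm_le => i; rewrite normrM ler_pM ?coord_norm_le. Qed.

Lemma dotr_norm_ge z : `|z| ^+ 2 <= dotr z z.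
Proof.
rewrite -ler_sqrt ?sqr_ge0 ?sumr_ge0// => [|i _]; last by rewrite -expr2 sqr_ge0.
rewrite sqrtr_sqr ger0_norm//; apply: norm_row_le => [|i]; first exact: sqrtr_ge0.
rewrite -sqrtr_sqr ler_wsqrtr// /dotr (bigD1 i)//= expr2 lerDl.
by apply: sumr_ge0 => j _; rewrite -expr2 sqr_ge0.
Qed.

Lemma dotrC z z' : dotr z z' = dotr z' z.
Proof. by apply: eq_bigr => i _; rewrite mulrC. Qed.

Lemma dotrDl z1 z2 z : dotr (z1 + z2) z = dotr z1 z + dotr z2 z.
Proof. by rewrite -big_split; apply: eq_bigr => i _; rewrite !mxE mulrDl. Qed.

Lemma dotrZl c z1 z : dotr (c *: z1) z = c * dotr z1 z.
Proof. by rewrite mulr_sumr; apply: eq_bigr => i _; rewrite !mxE mulrA. Qed.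

Lemma dotrNl z1 z : dotr (- z1) z = - dotr z1 z.
Proof. by rewrite -scaleN1r dotrZl mulN1r. Qed.

Lemma dotrDr z1 z2 z : dotr z (z1 + z2) = dotr z z1 + dotr z z2.
Proof. by rewrite !(dotrC z) dotrDl. Qed.

Lemma dotrNr z1 z : dotr z (- z1) = - dotr z z1.
Proof. by rewrite !(dotrC z) dotrNl. Qed.

Lemma dotrZr c z1 z : dotr z (c *: z1) = c * dotr z z1.
Proof. by rewrite !(dotrC z) dotrZl. Qed.

Lemma dotr_mulmx B z z' : dotr (z *m B) z' = dotr z (z' *m B^T).
Proof.
rewrite /dotr; under eq_bigr do rewrite mxE mulr_suml.
rewrite exchange_big; apply: eq_bigr => i _; rewrite mxE mulr_sumr.
by apply: eq_bigr => j _; rewrite mxE; ring.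
Qed.

Definition qf B z : R := dotr (z *m B) z.

Lemma qfE B z : qf B z = \sum_i \sum_j B i j * z ord0 i * z ord0 j.
Proof.
rewrite /qf /dotr exchange_big; apply: eq_bigr => i _; rewrite mxE mulr_suml.
by apply: eq_bigr => j _; ring.
Qed.

Lemma qf_norm_le B b z : 0 <= b -> (forall i j, `|B i j| <= b) ->
  `|qf B z| <= d%:R ^+ 2 * b * `|z| ^+ 2.
Proof.
move=> b0 Bb; apply: le_trans (dotr_norm_le _ _) _.
rewrite [leRHS](_ : _ = d%:R * ((d%:R * b * `|z|) * `|z|)); last by ring.
by rewrite ler_wpM2l// ler_wpM2r// mulmx_norm_le.
Qed.

Lemma qf_add B z h : B^T = B ->
  qf B (z + h) = qf B z + 2 * dotr (z *m B) h + qf B h.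
Proof.
move=> Bs; rewrite /qf mulmxDl !dotrDl !dotrDr.
by rewrite [dotr (h *m B) z]dotr_mulmx Bs [dotr h _]dotrC; ring.
Qed.

Lemma qf_dist B b z z' r : B^T = B -> 0 <= b -> (forall i j, `|B i j| <= b) ->
  `|z| <= r -> `|z'| <= r ->
  `|qf B z - qf B z'| <= 2 * d%:R ^+ 2 * b * r * `|z - z'|.
Proof.
move=> Bs b0 Bb zr z'r.
have r0 : 0 <= r by exact: le_trans (normr_ge0 _) zr.
have -> : qf B z - qf B z' = dotr ((z + z') *m B) (z - z').
  rewrite /qf mulmxDl dotrDl !dotrDr !dotrNr [dotr (z' *m B) z]dotr_mulmx Bs.
  by rewrite [dotr z' _]dotrC; ring.
apply: le_trans (dotr_norm_le _ _) _.
rewrite [leRHS](_ : _ = d%:R * ((d%:R * b * (r + r)) * `|z - z'|)); last by ring.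
rewrite ler_wpM2l// ler_wpM2r//.
apply: le_trans (mulmx_norm_le _ b0 Bb) _.
by rewrite ler_wpM2l ?mulr_ge0//; apply: le_trans (ler_normD _ _) (lerD zr z'r).
Qed.

(* The inverse matrices enter only through symmetry and these two bounds. *)
Definition good (b k : R) B :=
  [/\ B^T = B, forall i j, `|B i j| <= b & forall z, `|z| ^+ 2 <= k ^+ 2 * qf B z].

Lemma posdef_unitmx (lam : R) A : 0 < lam ->
  (forall z, lam * `|z| ^+ 2 <= qf A z) -> A \in unitmx.
Proof.
move=> lam0 Aell; rewrite -row_free_unit -kermx_eq0; apply/eqP/row_matrixP => i.
rewrite row0; apply/eqP; rewrite -normr_eq0 -sqrf_eq0.
have := Aell (row i (kermx A)); rewrite /qf -row_mul mulmx_ker row0.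
rewrite /dotr big1 => [|j _]; last by rewrite !mxE mul0r.
rewrite pmulr_rle0// => h.
by rewrite eq_le h sqr_ge0.
Qed.

(** Coercivity of [A] at the row z A^-1 gives lam |z A^-1|^2 <= q(z), with q the form of the
    inverse. Taking unit rows for z bounds the entries. Writing z = (z A^-1) A gives |z| <= d M |z
    A^-1|, and the condition on [k] turns this into the third clause of [good]. *)
Lemma good_invmx (lam M k : R) A : 0 < lam -> 0 <= M -> A^T = A ->
  (d%:R * M) ^+ 2 <= k ^+ 2 * lam ->
  (forall z, lam * `|z| ^+ 2 <= qf A z) -> (forall i j, `|A i j| <= M) ->
  good (d%:R / lam) k (invmx A).
Proof.
move=> lam0 M0 As kM Aell AM; have Au := posdef_unitmx lam0 Aell.
have Bs : (invmx A)^T = invmx A by rewrite trmx_inv As.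
have qle z : lam * `|z *m invmx A| ^+ 2 <= qf (invmx A) z.
  by apply: le_trans (Aell _) _; rewrite /qf mulmxKV// dotrC.
split => // [i j|z].
  pose e := delta_mx ord0 i : 'rV[R]_d.
  have -> : invmx A i j = (e *m invmx A) ord0 j by rewrite -rowE mxE.
  apply: le_trans (coord_norm_le _ _) _.
  have e1 : `|e| <= 1.
    apply: norm_row_le => // l; rewrite mxE eqxx /=.
    by case: eqP => _; rewrite ?normr1 ?normr0.
  have := le_trans (qle e) (le_trans (ler_norm _) (dotr_norm_le _ _)).
  set y := `|_ *m _|; move=> h; have y0 : 0 <= y by exact: normr_ge0.
  have [->|yn0] := eqVneq y 0; first by rewrite divr_ge0// ltW.
  have yp : 0 < y by rewrite lt_def yn0.
  rewrite ler_pdivlMr// mulrC -(ler_pM2r yp) -mulrA -expr2 (le_trans h)//.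
  by rewrite ler_wpM2l// ler_piMr.
have zle : `|z| <= d%:R * M * `|z *m invmx A|.
  by rewrite -{1}(mulmxKV Au z); exact: mulmx_norm_le.
apply: (@le_trans _ _ ((d%:R * M) ^+ 2 * `|z *m invmx A| ^+ 2)).
  by rewrite -exprMn lerXn2r// nnegrE ?mulr_ge0.
apply: le_trans (ler_wpM2r (sqr_ge0 _) kM) _.
by rewrite -mulrA ler_wpM2l// sqr_ge0.
Qed.

(** Resolvent identity; it transfers the Hoelder modulus of the coefficients to the matrices that
    define the weights. *)
Lemma invmx_dist (b m : R) (A A' : 'M[R]_d) : 0 <= b -> A \in unitmx -> A' \in unitmx ->
  (forall i j, `|invmx A i j| <= b) -> (forall i j, `|invmx A' i j| <= b) ->
  (forall i j, `|A i j - A' i j| <= m) ->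
  forall i j, `|invmx A i j - invmx A' i j| <= d%:R ^+ 2 * b ^+ 2 * m.
Proof.
move=> b0 Au A'u Ab A'b AA' i j.
have -> : invmx A i j - invmx A' i j = (invmx A *m (A' - A) *m invmx A') i j.
  by rewrite mulmxBr mulmxBl mulmxK// mulVmx// mul1mx !mxE.
have -> : (invmx A *m (A' - A) *m invmx A') i j =
    \sum_k \sum_l invmx A i l * (A' - A) l k * invmx A' k j.
  by rewrite mxE; apply: eq_bigr => k _; rewrite mxE mulr_suml.
rewrite -mulrA; apply: sum2_norm_le => k l.
rewrite !normrM [leRHS](_ : _ = b * m * b); last by ring.
by rewrite ler_pM// ler_pM// !mxE distrC.
Qed.

End row_bounds.

(** * The truncated paraboloid and its Hessian: size, support, dependence on centre and matrix *)

Section parab.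
Context {R : realType} {d : nat}.
Implicit Types (x y z : 'rV[R]_d) (A B : 'M[R]_d).

Definition parab B y (t : R) x : R := Num.max 0 (t ^+ 2 - qf B (x - y)).

(* The Hessian of [parab B y t ^+ 3]. *)
Definition hess B y (t : R) i j x : R :=
  24 * parab B y t x * ((x - y) *m B) ord0 i * ((x - y) *m B) ord0 j
  - 6 * parab B y t x ^+ 2 * B i j.

Lemma parab_ge0 B y t x : 0 <= parab B y t x.
Proof. by rewrite /parab le_max lexx. Qed.

Lemma max0_dist (a c : R) : `|Num.max 0 a - Num.max 0 c| <= `|a - c|.
Proof.
by rewrite /Num.max; case: ifP => h1; case: ifP => h2;
  rewrite ?subrr ?subr0 ?sub0r ?normr0 ?normrN//; rewrite ler_norml;
  case: (ger0P (a - c)) => ?; lra.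
Qed.

Section good_parab.
Variables (b k : R).
Hypotheses (b0 : 0 <= b) (k0 : 0 <= k).

Lemma good_qf_ge0 B z : good b k B -> 0 <= qf B z.
Proof.
move=> [_ _ gB]; have := le_trans (sqr_ge0 `|z|) (gB z).
(* The third clause of [good] yields k^2 q(z) >= 0, which is uninformative for k = 0; in that case
   the clause forces z = 0. *)
have [kE|kn0] := eqVneq k 0; last by rewrite pmulr_rge0// exprn_gt0// lt_def kn0.
move=> _; have h : `|z| ^+ 2 <= 0 by have := gB z; rewrite kE expr0n mul0r.
have /eqP : `|z| = 0 by apply/eqP; rewrite -sqrf_eq0 eq_le h sqr_ge0.
by rewrite normr_eq0 => /eqP ->; rewrite /qf /dotr big1 //= => i _; rewrite [X in _ * X]mxE mulr0.
Qed.

Lemma parab_le B y t x : good b k B -> parab B y t x <= t ^+ 2.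
Proof. by move=> gB; rewrite /parab ge_max sqr_ge0 gerBl good_qf_ge0. Qed.

(** The third clause of [good] makes the form exceed t^2 once |x - y| exceeds k t. Supports are
    thereby controlled by sup-norm balls that do not depend on the matrix. *)
Lemma parab_supp B y t x : good b k B -> 0 <= t -> k * t < `|x - y| ->
  parab B y t x = 0.
Proof.
move=> gB t0 ktx; apply/max_idPl; rewrite subr_le0 leNgt; apply/negP => qt.
case: gB => _ _ /(_ (x - y)); apply/negP; rewrite -ltNge.
apply: (@le_lt_trans _ _ ((k * t) ^+ 2)).
  by rewrite exprMn ler_wpM2l ?sqr_ge0// ltW.
by rewrite ltr_pXn2r ?nnegrE ?mulr_ge0.
Qed.

Lemma hess_supp B y t x i j : good b k B -> 0 <= t -> k * t < `|x - y| ->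
  hess B y t i j x = 0.
Proof. by move=> gB t0 kt; rewrite /hess (parab_supp gB)// expr0n !(mulr0, mul0r) subr0. Qed.

Lemma parab_dist B y y' t x r : good b k B -> `|x - y| <= r -> `|x - y'| <= r ->
  `|parab B y t x - parab B y' t x| <= 2 * d%:R ^+ 2 * b * r * `|y - y'|.
Proof.
move=> [Bs Bb _] h h'; apply: le_trans (max0_dist _ _) _.
rewrite (_ : _ - _ = qf B (x - y') - qf B (x - y)); last by ring.
rewrite (_ : `|y - y'| = `|x - y' - (x - y)|); last by rewrite opprB [x - y' + _]addrC subrKA.
exact: qf_dist.
Qed.

Lemma linear_coord_norm_le B z r i : good b k B -> `|z| <= r ->
  `|(z *m B) ord0 i| <= d%:R * b * r.
Proof.
move=> [_ Bb _] zr; apply: le_trans (coord_norm_le _ _) _.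
by apply: le_trans (mulmx_norm_le _ b0 Bb) _; rewrite ler_wpM2l ?mulr_ge0.
Qed.

(** On the support the paraboloid is at most t^2 and the coordinates of (x - y) B are of order t, so
    both terms of the Hessian are of order t^4. *)
Lemma hess_norm_le : exists2 C : R, 0 <= C & forall B y t x i j,
  good b k B -> 0 <= t -> `|hess B y t i j x| <= C * t ^+ 4.
Proof.
exists (24 * (d%:R * b * k) ^+ 2 + 6 * b) => [|B y t x i j gB t0].
  by rewrite addr_ge0// mulr_ge0// sqr_ge0.
have [kt|xy] := ltP (k * t) `|x - y|.
  by rewrite (hess_supp _ _ gB)// normr0 mulr_ge0 ?exprn_ge0// addr_ge0// mulr_ge0// sqr_ge0.
have w0 := parab_ge0 B y t x; have wt := parab_le y t x gB.
have l1 := linear_coord_norm_le i gB xy; have l2 := linear_coord_norm_le j gB xy.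
apply: le_trans (ler_normB _ _) _; rewrite [leRHS]mulrDl; apply: lerD.
  rewrite [leRHS](_ : _ = 24 * t ^+ 2 * (d%:R * b * (k * t)) * (d%:R * b * (k * t))); last by ring.
  by rewrite !normrM [`|24|]ger0_norm// [`|parab _ _ _ _|]ger0_norm// !ler_pM// ?mulr_ge0.
rewrite [leRHS](_ : _ = 6 * (t ^+ 2) ^+ 2 * b); last by ring.
rewrite normrM [`|6 * _|]ger0_norm ?mulr_ge0 ?sqr_ge0//.
case: (gB) => _ Bb _.
by rewrite !ler_pM ?mulr_ge0 ?sqr_ge0// lerXn2r ?nnegrE ?sqr_ge0.
Qed.

Lemma sqr_dist_le (w w' m e : R) : 0 <= w <= m -> 0 <= w' <= m -> `|w - w'| <= e ->
  `|w ^+ 2 - w' ^+ 2| <= e * (2 * m).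
Proof.
move=> /andP[w0 wm] /andP[w0' wm'] h; rewrite subr_sqr normrM ler_pM//.
by rewrite ger0_norm ?addr_ge0// mulr2n mulrDl mul1r lerD.
Qed.

(** Case split for comparing two centres: outside both supports there is nothing to estimate, and
    otherwise the point is close enough to both centres for the Lipschitz bounds to apply. *)
Lemma near_supp y y' t x : 0 <= t -> `|y - y'| <= t ->
  (k * t < `|x - y|) && (k * t < `|x - y'|) \/
  `|x - y| <= (k + 1) * t /\ `|x - y'| <= (k + 1) * t.
Proof.
move=> t0 yt.
have h1 : `|x - y| <= `|x - y'| + `|y - y'|.
  by rewrite [`|y - y'|]distrC -[x - y](subrKA y') ler_normD.
have h2 : `|x - y'| <= `|x - y| + `|y - y'|.
  by rewrite -[x - y'](subrKA y) ler_normD.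
have [g1|g1] := ltP (k * t) `|x - y|; have [g2|g2] := ltP (k * t) `|x - y'|;
  by [left | right; split; lra].
Qed.

Lemma parab2_dist : exists2 C : R, 0 <= C & forall B y y' t x,
  good b k B -> 0 <= t -> `|y - y'| <= t ->
  `|parab B y t x ^+ 2 - parab B y' t x ^+ 2| <= C * t ^+ 3 * `|y - y'|.
Proof.
exists (4 * d%:R ^+ 2 * b * (k + 1)) => [|B y y' t x gB t0 yt].
  by rewrite !mulr_ge0 ?exprn_ge0 ?addr_ge0.
case: (near_supp x t0 yt) => [/andP[? ?]|[h h']].
  by rewrite !(parab_supp gB)// subrr normr0 !mulr_ge0 ?exprn_ge0 ?addr_ge0.
apply: le_trans (sqr_dist_le _ _ (parab_dist t gB h h')) _.
- by rewrite parab_ge0; exact: parab_le gB.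
- by rewrite parab_ge0; exact: parab_le gB.
by rewrite le_eqVlt; apply/orP; left; apply/eqP; ring.
Qed.

Lemma parab2_dist_mx : exists2 C : R, 0 <= C & forall B B' y t x m,
  good b k B -> good b k B' -> 0 <= t -> (forall i j, `|B i j - B' i j| <= m) -> 0 <= m ->
  `|parab B y t x ^+ 2 - parab B' y t x ^+ 2| <= C * t ^+ 4 * m.
Proof.
exists (2 * d%:R ^+ 2 * k ^+ 2) => [|B B' y t x m gB gB' t0 BB m0].
  by rewrite !mulr_ge0 ?exprn_ge0.
have [g1|g1] := ltP (k * t) `|x - y|.
  by rewrite (parab_supp gB)// (parab_supp gB')// subrr normr0 !mulr_ge0 ?exprn_ge0.
apply: le_trans (@sqr_dist_le _ _ (t ^+ 2) (d%:R ^+ 2 * m * (k * t) ^+ 2) _ _ _) _.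
- by rewrite parab_ge0; exact: parab_le gB.
- by rewrite parab_ge0; exact: parab_le gB'.
- apply: le_trans (max0_dist _ _) _.
  rewrite (_ : _ - _ = qf (B' - B) (x - y)); last first.
    by rewrite /qf mulmxBr dotrDl dotrNl; ring.
  apply: (@le_trans _ _ (d%:R ^+ 2 * m * `|x - y| ^+ 2)).
    by apply: qf_norm_le => // i j; rewrite !mxE distrC.
  by rewrite ler_wpM2l ?mulr_ge0 ?sqr_ge0// lerXn2r ?nnegrE ?mulr_ge0.
by rewrite le_eqVlt; apply/orP; left; apply/eqP; ring.
Qed.

Lemma mul3_dist_le (w w' l l' m m' W L e f : R) :
  `|w| <= W -> `|w'| <= W -> `|l| <= L -> `|l'| <= L -> `|m| <= L -> `|m'| <= L ->
  `|w - w'| <= e -> `|l - l'| <= f -> `|m - m'| <= f ->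
  `|w * l * m - w' * l' * m'| <= e * L * L + W * f * L + W * L * f.
Proof.
move=> wW wW' lL lL' mL mL' we lf mf.
rewrite (_ : _ - _ = (w - w') * l * m + w' * (l - l') * m + w' * l' * (m - m')); last by ring.
apply: le_trans (ler_normD _ _) _; rewrite lerD//.
  apply: le_trans (ler_normD _ _) _.
  by rewrite lerD// !normrM !ler_pM// ?mulr_ge0.
by rewrite !normrM !ler_pM// ?mulr_ge0.
Qed.

(** Compared with the bound of order t^4 on a single Hessian, the difference gains the factor |y -
    y'| / t. The constant depends on [b], [k] and the dimension only. *)
Lemma hess_dist : exists2 C : R, 0 <= C & forall B y y' t x i j,
  good b k B -> 0 <= t -> `|y - y'| <= t ->
  `|hess B y t i j x - hess B y' t i j x| <= C * t ^+ 3 * `|y - y'|.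
Proof.
have [C1 C10 hC1] := parab2_dist.
pose L := d%:R * b * (k + 1).
exists (24 * (2 * d%:R ^+ 2 * b * (k + 1) * L * L + d%:R * b * L + L * (d%:R * b))
   + 6 * C1 * b) => [|B y y' t x i j gB t0 yt].
  by rewrite /L !(addr_ge0, mulr_ge0) ?exprn_ge0.
case: (near_supp x t0 yt) => [/andP[? ?]|[h h']].
  by rewrite !(hess_supp _ _ gB)// subrr normr0 /L !(addr_ge0, mulr_ge0) ?exprn_ge0.
rewrite /hess.
set w := parab B y t x; set w' := parab B y' t x.
set l := ((x - y) *m B) ord0 i; set m := ((x - y) *m B) ord0 j.
set l' := ((x - y') *m B) ord0 i; set m' := ((x - y') *m B) ord0 j.
have ww' := parab_dist t gB h h'.
have hw : `|w| <= t ^+ 2 by rewrite ger0_norm ?parab_ge0 ?(parab_le _ _ _ gB).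
have hw' : `|w'| <= t ^+ 2 by rewrite ger0_norm ?parab_ge0 ?(parab_le _ _ _ gB).
have ld c : `|((x - y) *m B) ord0 c - ((x - y') *m B) ord0 c| <= d%:R * b * `|y - y'|.
  rewrite (_ : _ - _ = ((y' - y) *m B) ord0 c); last first.
    have -> : y' - y = (x - y) - (x - y') by rewrite opprB [RHS]addrC subrKA.
    by rewrite [in RHS]mulmxBl [RHS]mxE [X in _ = _ + X]mxE.
  by rewrite distrC; exact: linear_coord_norm_le gB _.
have := mul3_dist_le hw hw' (linear_coord_norm_le i gB h) (linear_coord_norm_le i gB h')
  (linear_coord_norm_le j gB h) (linear_coord_norm_le j gB h') ww' (ld i) (ld j).
rewrite -/l -/l' -/m -/m' -/w -/w' => h3.
have hb := hC1 _ _ _ _ x gB t0 yt; rewrite -/w -/w' in hb.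
case: (gB) => _ Bb _.
rewrite (_ : _ - _ = 24 * (w * l * m - w' * l' * m')
  - 6 * (w ^+ 2 - w' ^+ 2) * B i j); last by ring.
apply: le_trans (ler_normB _ _) _.
rewrite [leRHS](_ : _ = 24 * (2 * d%:R ^+ 2 * b * ((k + 1) * t) * `|y - y'| *
      (d%:R * b * ((k + 1) * t)) * (d%:R * b * ((k + 1) * t)) +
      t ^+ 2 * (d%:R * b * `|y - y'|) * (d%:R * b * ((k + 1) * t)) +
      t ^+ 2 * (d%:R * b * ((k + 1) * t)) * (d%:R * b * `|y - y'|)) +
      6 * (C1 * t ^+ 3 * `|y - y'|) * b); last by rewrite /L; ring.
rewrite lerD//.
  by rewrite normrM [`|24|]ger0_norm// ler_wpM2l.
by rewrite !normrM [`|6|]ger0_norm// !ler_pM// ?mulr_ge0.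
Qed.

End good_parab.

(** As A inverts B, the form of A at (x - y) B is the form of B at x - y, so the trace depends on x
    through that form alone. The product of the paraboloid with the form is t^2 w - w^2, also where
    the truncation is active, since both sides vanish there. *)
Lemma trace_hess A B y t x : B^T = B -> B *m A = 1%:M ->
  \sum_i \sum_j A i j * hess B y t i j x =
  24 * t ^+ 2 * parab B y t x - (6 * d%:R + 24) * parab B y t x ^+ 2.
Proof.
move=> Bs BA; pose z := x - y.
have -> : \sum_i \sum_j A i j * hess B y t i j x =
    24 * parab B y t x * qf A (z *m B) - 6 * parab B y t x ^+ 2 * \tr (B *m A).
  have -> : \tr (B *m A) = \sum_i \sum_j A i j * B i j.
    rewrite /mxtrace; under eq_bigr do rewrite mxE.
    rewrite exchange_big; apply: eq_bigr => i _; apply: eq_bigr => j _.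
    by rewrite mulrC -[in B j i]Bs mxE.
  rewrite qfE !mulr_sumr -sumrB; apply: eq_bigr => i _.
  by rewrite !mulr_sumr -sumrB; apply: eq_bigr => j _; rewrite /hess; ring.
rewrite BA mxtrace1 /qf -mulmxA BA mulmx1 dotrC -/(qf B z).
rewrite /parab -/z; case: (leP 0 (t ^+ 2 - qf B z)) => _; ring.
Qed.

End parab.

(** Explicit second-order remainders survive integration in x, so the same criterion serves for the
    paraboloid and, later, for its integrals as functions of the radius. *)
Lemma is_derive_quadratic {R : realType} (V : normedModType R) (f : V -> R) (x v : V) (l C : R) :
  (forall h : R, `|h| <= 1 -> `|f (h *: v + x) - f x - h * l| <= C * h ^+ 2) ->
  is_derive x v f l.
Proof.
move=> fC.
suff H : h^-1 *: (f (h *: v + x) - f x) @[h --> 0^'] --> l.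
  by split; [apply/cvg_ex; exists l | exact/cvg_lim].
apply/cvgrPdist_le => e e0; near=> h.
have h0 : h != 0 by near: h; exact: nbhs_dnbhs_neq.
have hp : 0 < `|h| by rewrite normr_gt0.
have h1 : `|h| <= 1 by near: h; apply: dnbhs0_le.
have he : `|h| <= e / (`|C| + 1).
  by near: h; apply: dnbhs0_le; rewrite divr_gt0// ltr_wpDl.
rewrite distrC -(ler_pM2l hp) -normrM.
rewrite (_ : h * _ = f (h *: v + x) - f x - h * l); last first.
  by rewrite /GRing.scale/=; field.
apply: le_trans (fC _ h1) _; rewrite -[h ^+ 2]ger0_norm ?sqr_ge0// normrX expr2 mulrCA.
rewrite ler_wpM2l//; rewrite ler_pdivlMr ?ltr_wpDl// in he.
apply: le_trans he; rewrite mulrC ler_wpM2l//.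
by rewrite (le_trans (ler_norm _))// lerDl.
Unshelve. all: by end_near. Qed.

(** The squared positive part has a Lipschitz derivative, so the first-order expansion keeps a
    quadratic remainder even across the kink. *)
Lemma max0_sqr_quadratic {R : realDomainType} (s e : R) :
  `|Num.max 0 (s + e) ^+ 2 - Num.max 0 s ^+ 2 - 2 * Num.max 0 s * e| <= e ^+ 2.
Proof.
case: (leP 0 (s + e)) => h1; case: (leP 0 s) => h2; rewrite ler_norml; nra.
Qed.

(** * The cube of the paraboloid as a test function of class C^2 *)

Section parab_cube.
Context {R : realType} {d : nat}.
Implicit Types (x y z : 'rV[R]_d) (B : 'M[R]_d).
Variables (B : 'M[R]_d) (y : 'rV[R]_d) (t : R).
Hypothesis Bs : B^T = B.

Let p x := t ^+ 2 - qf B (x - y).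

Let p_step x v h : p (h *: v + x) =
  p x - h * (2 * dotr ((x - y) *m B) v) - h ^+ 2 * qf B v.
Proof.
rewrite /p (_ : h *: v + x - y = (x - y) + h *: v); last by rewrite -addrA addrC.
rewrite qf_add// [in LHS]/(qf _ (h *: v)) -scalemxAl dotrZl !dotrZr.
by rewrite -/(qf B v); ring.
Qed.

Let is_derive_p x v : is_derive x v p (- (2 * dotr ((x - y) *m B) v)).
Proof.
apply: (@is_derive_quadratic _ _ _ _ _ _ `|qf B v|) => h _; rewrite p_step.
rewrite (_ : _ - _ - _ = - (qf B v * h ^+ 2)); last by ring.
by rewrite normrN normrM [`|h ^+ 2|]ger0_norm ?sqr_ge0.
Qed.

Lemma is_derive_parab_sqr x v :
  is_derive x v (fun x => parab B y t x ^+ 2)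
    (2 * parab B y t x * (- (2 * dotr ((x - y) *m B) v))).
Proof.
set D := 2 * dotr _ v; set q := qf B v; set w := parab B y t x.
(* The first summand bounds the square of the increment - h (D + h q) for |h| <= 1; the second
   absorbs the part h^2 q of the increment, which is not linear in h. *)
apply: (@is_derive_quadratic _ _ _ _ _ _ ((`|D| + `|q|) ^+ 2 + `|2 * w * q|)) => h h1.
have := max0_sqr_quadratic (p x) (- (h * D) - h ^+ 2 * q).
rewrite addrA -p_step -/(parab B y t _) -[Num.max 0 (p x)]/w => e1.
rewrite /= -/w; set w' := parab B y t (h *: v + x) in e1 *.
have -> : w' ^+ 2 - w ^+ 2 - h * (2 * w * - D) = w' ^+ 2 - w ^+ 2 -
  2 * w * (- (h * D) - h ^+ 2 * q) - 2 * w * q * h ^+ 2 by ring.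
apply: le_trans (ler_normB _ _) _; rewrite [leRHS]mulrDl; apply: lerD.
  apply: le_trans e1 _; rewrite -exprMn -[leLHS]real_normK ?num_real//.
  rewrite -[leRHS]real_normK ?num_real// lerXn2r ?nnegrE// [leRHS]normrM.
  have -> : - (h * D) - h ^+ 2 * q = - (h * (D + h * q)) by ring.
  rewrite normrN normrM mulrC ler_wpM2r// (le_trans (ler_normD _ _))//.
  rewrite [leRHS]ger0_norm ?addr_ge0// lerD2l.
  by rewrite normrM ler_piMl.
by rewrite normrM [`|h ^+ 2|]ger0_norm ?sqr_ge0.
Qed.

(** Trades one truncated factor for the polynomial [p], so that the product rule applies to two
    functions already differentiated. *)
Lemma parab_cubeE x : parab B y t x ^+ 3 = p x * parab B y t x ^+ 2.
Proof. by rewrite /parab -/(p x); case: (leP 0 (p x)) => _; ring. Qed.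

Lemma is_derive_parab_cube x v :
  is_derive x v (fun x => parab B y t x ^+ 3)
    (- 6 * parab B y t x ^+ 2 * dotr ((x - y) *m B) v).
Proof.
rewrite (_ : (fun _ => _) = p * (fun x => parab B y t x ^+ 2)); last first.
  by apply/funext => z; rewrite parab_cubeE.
have h1 := is_derive_p x v; have h2 := is_derive_parab_sqr x v.
apply: is_derive_eq; rewrite /GRing.scale/=.
rewrite [in p x * _](_ : p x * _ =
  - 4 * (p x * parab B y t x) * dotr ((x - y) *m B) v); last by ring.
have -> : p x * parab B y t x = parab B y t x ^+ 2.
  by rewrite /parab -/(p x); case: (leP 0 (p x)) => _; ring.
by ring.
Qed.

Lemma dotr_delta z i : dotr z (delta_mx ord0 i) = z ord0 i.
Proof.
rewrite /dotr (bigD1 i)//= mxE !eqxx mulr1 big1 ?addr0// => j ji.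
by rewrite mxE (negbTE ji) andbF mulr0.
Qed.

Lemma partial_parab_cube i :
  partial i (fun x => parab B y t x ^+ 3) =
  (fun x => - 6 * parab B y t x ^+ 2 * ((x - y) *m B) ord0 i).
Proof.
apply/funext => x; rewrite /partial.
by have h := is_derive_parab_cube x (delta_mx ord0 i); rewrite derive_val dotr_delta.
Qed.

Lemma is_derive_linear_coord x v i :
  is_derive x v (fun x => ((x - y) *m B) ord0 i) ((v *m B) ord0 i).
Proof.
apply: (@is_derive_quadratic _ _ _ _ _ _ 0) => h _.
have -> : ((h *: v + x - y) *m B) ord0 i = h * (v *m B) ord0 i + ((x - y) *m B) ord0 i.
  by rewrite -addrA mulmxDl -scalemxAl mxE [X in X + _]mxE.
by rewrite addrK subrr normr0 mul0r.
Qed.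

Lemma is_derive_partial_parab_cube i j x :
  is_derive x (delta_mx ord0 j)
    (fun x => - 6 * parab B y t x ^+ 2 * ((x - y) *m B) ord0 i) (hess B y t i j x).
Proof.
rewrite (_ : (fun _ => _) = - 6 *: ((fun x => parab B y t x ^+ 2) *
   (fun x => ((x - y) *m B) ord0 i))); last first.
  by apply/funext => z; rewrite -mulrA.
have h1 := is_derive_parab_sqr x (delta_mx ord0 j).
have h2 := is_derive_linear_coord x (delta_mx ord0 j) i.
apply: is_derive_eq; rewrite /hess dotr_delta -rowE [row j B ord0 i]mxE /GRing.scale/=.
rewrite (_ : B i j = B j i); last by rewrite -[in LHS]Bs mxE.
by ring.
Qed.

Lemma partial2_parab_cube i j :
  partial j (partial i (fun x => parab B y t x ^+ 3)) = hess B y t i j.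
Proof.
rewrite partial_parab_cube; apply/funext => x; rewrite /partial.
by have h := is_derive_partial_parab_cube i j x; rewrite derive_val.
Qed.

Let cont_coordB j : continuous (fun x => (x - y) ord0 j).
Proof.
rewrite (_ : (fun _ => _) = (fun x : 'rV[R]_d => x ord0 j - y ord0 j)); last first.
  by apply/funext => z; rewrite !mxE.
move=> x; apply: continuousB; [exact: (@coord_continuous R _ _ ord0 j)|exact: cst_continuous].
Qed.

Let cont_linear_coord i : continuous (fun x => ((x - y) *m B) ord0 i).
Proof.
rewrite (_ : (fun _ => _) = (fun x => \sum_j (x - y) ord0 j * B j i)); last first.
  by apply/funext => x; rewrite mxE.
apply: continuous_big; first exact: add_continuous.
by move=> j _ x; apply: continuousM; [exact: cont_coordB|exact: cst_continuous].
Qed.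

Lemma cont_parab : continuous (parab B y t).
Proof.
move=> x; apply: (@continuous_max _ _ (cst 0) p); first exact: cst_continuous.
apply: continuousB; first exact: cst_continuous.
rewrite /qf /dotr; move: x; apply: continuous_big; first exact: add_continuous.
move=> i _ x; apply: continuousM; first exact: cont_linear_coord.
exact: cont_coordB.
Qed.

Let cont_parabX n : continuous (fun x => parab B y t x ^+ n).
Proof.
move=> x; apply: (@continuous_comp _ _ _ (parab B y t) (fun r : R => r ^+ n)).
  exact: cont_parab.
exact: exprn_continuous.
Qed.

Lemma parab_cube_C2 : C2 (fun x => parab B y t x ^+ 3).
Proof.
split=> [|i|i j]; first exact: cont_parabX.
- split=> [x|]; first by have [] := is_derive_parab_cube x (delta_mx ord0 i).
  rewrite partial_parab_cube => x.
  apply: (@continuousM _ _ (fun x => - 6 * parab B y t x ^+ 2)).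
    by apply: continuousM; [exact: cst_continuous|exact: cont_parabX].
  exact: cont_linear_coord.
- split=> [x|]; first by rewrite partial_parab_cube; have [] := is_derive_partial_parab_cube i j x.
  rewrite partial2_parab_cube => x; rewrite /hess.
  apply: (@continuousB _ _ _
    (fun x => 24 * parab B y t x * ((x - y) *m B) ord0 i * ((x - y) *m B) ord0 j)
    (fun x => 6 * parab B y t x ^+ 2 * B i j)).
    apply: continuousM; last exact: cont_linear_coord.
    apply: continuousM; last exact: cont_linear_coord.
    by apply: continuousM; [exact: cst_continuous|exact: cont_parab].
  apply: continuousM; last exact: cst_continuous.
  by apply: continuousM; [exact: cst_continuous|exact: cont_parabX].
Qed.

End parab_cube.

(** * Measurability of open sets and volume of sup-norm balls *)

Section row_measurability.
Context {R : realType} {d : nat}.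
Implicit Types (x y : 'rV[R]_d) (D O : set 'rV[R]_d).

Lemma measurable_ball_row y (r : R) : measurable [set x : 'rV[R]_d | `|x - y| < r].
Proof.
have [r0|r0] := leP r 0.
  rewrite (_ : [set _ | _] = set0) ?measurable0//.
  by apply/seteqP; split => // x /=; rewrite ltNge (le_trans r0).
rewrite (_ : [set _ | _] = \big[setI/setT]_(i < d)
   ((fun x : 'rV[R]_d => x ord0 i) @^-1` `]y ord0 i - r, y ord0 i + r[%classic)); last first.
  rewrite -bigcap_seq; apply/seteqP; split => x /=.
    move=> xy i _; rewrite /= in_itv/=.
    have := le_lt_trans (coord_norm_le (x - y) i) xy.
    by rewrite !mxE ltr_distl.
  move=> h; rewrite -[x - y]/(x - y) /Num.norm/= mx_normrE.
  apply: bigmax_lt => // -[i j] _ /=; rewrite (ord1 i) !mxE ltr_distl.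
  by have := h j; rewrite /= in_itv/=; apply; rewrite mem_index_enum.
apply: bigsetI_measurable => i _.
by rewrite -[X in measurable X]setTI; apply: measurable_coord.
Qed.

Lemma row_rat_approx x (e : R) : 0 < e ->
  exists q : 'rV[rat]_d, `|map_mx ratr q - x| < e.
Proof.
move=> e0.
have h i : exists q : rat, `|ratr q - x ord0 i| < e.
  have [|q] := @rat_in_itvoo R (x ord0 i - e) (x ord0 i + e).
    by rewrite ltrBlDr -addrA ltrDl addr_gt0.
  by rewrite in_itv/= => hq; exists q; rewrite ltr_distl.
have [q hq] := choice h.
exists (\row_i q i); rewrite /Num.norm/= mx_normrE.
by apply: bigmax_lt => // -[i j] _ /=; rewrite (ord1 i) !mxE.
Qed.

(** The sigma-algebra is generated by the coordinates, so an open set is exhibited as a countable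
    union of boxes: the cubes with rational centre and radius 1 / (n + 1) that it contains,
    enumerated by [unpickle]. *)
Lemma measurable_open_row O : open O -> measurable O.
Proof.
move=> oO.
pose c (p : 'rV[rat]_d * nat) : set 'rV[R]_d :=
  [set x : 'rV[R]_d | `|x - map_mx ratr p.1| < p.2.+1%:R^-1].
pose F n := if @unpickle ('rV[rat]_d * nat)%type n is Some p then
  if `[< c p `<=` O >] then c p else set0 else set0.
rewrite (_ : O = \bigcup_n F n).
  apply: bigcupT_measurable => n; rewrite /F; case: unpickle => // p.
  by case: asboolP => // _; exact: measurable_ball_row.
apply/seteqP; split => [x Ox|x [n _]]; last first.
  by rewrite /F; case: unpickle => // p; case: asboolP => // cO /cO.
have /nbhs_ballP[e /= e0 xe] := open_nbhs_nbhs (conj oO Ox).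
have [N Ne] : exists N : nat, N.+1%:R^-1 < e / 2.
  have e20 : 0 < e / 2 by rewrite divr_gt0.
  exists (Num.trunc (e / 2)^-1); rewrite -[ltRHS]invrK ltf_pV2 ?posrE ?invr_gt0//.
  exact: truncnS_gt.
have N0 : (0 : R) < N.+1%:R^-1 by rewrite invr_gt0.
have [q qx] := row_rat_approx x N0.
exists (pickle (q, N)) => //; rewrite /F pickleK.
have cO : c (q, N) `<=` O.
  move=> z; rewrite /c/= => zq; apply: xe; rewrite -ball_normE/=.
  rewrite -(subrKA (map_mx ratr q)) (le_lt_trans (ler_normD _ _))//.
  rewrite [e]splitr ltrD//; first by rewrite distrC (lt_trans qx).
  by rewrite distrC (lt_trans zq).
by case: asboolP => // _; rewrite /c/= distrC.
Qed.

Lemma open_continuous_measurable O (f : 'rV[R]_d -> R) : open O ->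
  (forall x, O x -> {for x, continuous f}) -> measurable_fun O f.
Proof.
move=> oO fO mO; apply: (measurability _ (RGenOInfty.measurableE R)) => //.
move=> /= _ [_ [a ->] <-]; rewrite preimage_itvoy.
apply: measurable_open_row; rewrite openE => x [Ox /= ax].
apply: filterI; first exact: open_nbhs_nbhs.
exact: (fO x Ox _ (open_nbhs_nbhs (conj (@open_gt R a) ax))).
Qed.

Lemma continuous_measurable_row D (f : 'rV[R]_d -> R) : continuous f ->
  measurable_fun D f.
Proof.
move=> cf; apply: (@measurable_funS _ _ _ _ setT) => //.
apply: open_continuous_measurable => [|x _]; [exact: openT|exact: cf].
Qed.

Lemma closed_closed_ball_row y (r : R) : closed [set x : 'rV[R]_d | `|x - y| <= r].
Proof.
have cn : continuous (fun x : 'rV[R]_d => `|x - y|).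
  move=> x; apply: (@continuous_comp _ _ _ (fun x => x - y) (@Num.norm R _)).
    by apply: continuousB; [exact: id|exact: cst_continuous].
  exact: norm_continuous.
rewrite (_ : [set _ | _] = (fun x => `|x - y|) @^-1` [set s | s <= r])//.
by move/continuous_closedP: cn; apply; exact: closed_le.
Qed.

Lemma measurable_closed_ball_row y (r : R) :
  measurable [set x : 'rV[R]_d | `|x - y| <= r].
Proof.
rewrite -[X in measurable X]setCK; apply: measurableC; apply: measurable_open_row.
by rewrite openC; exact: closed_closed_ball_row.
Qed.

Lemma lebesgue_closed_ball_row y (r : R) : 0 <= r ->
  lebesgue_rV [set x : 'rV[R]_d | `|x - y| <= r] = ((2 * r) ^+ d)%:E.
Proof.
move=> r0; pose a := \row_i (y ord0 i - r); pose b := \row_i (y ord0 i + r).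
rewrite (_ : [set _ | _] = [set x : 'rV[R]_d | forall i, x ord0 i \in `[a ord0 i, b ord0 i]]).
  rewrite lebesgue_rV_box => [|i]; last by rewrite !mxE; lra.
  rewrite (eq_bigr (fun=> 2 * r)) => [|i _]; first by rewrite prodr_const card_ord.
  by rewrite !mxE; ring.
apply/seteqP; split => x /= h.
  move=> i; rewrite in_itv/= !mxE -ler_distl.
  by have := le_trans (coord_norm_le _ i) h; rewrite !mxE.
apply: norm_row_le => // i; rewrite !mxE ler_distl.
by have := h i; rewrite in_itv/= !mxE.
Qed.

End row_measurability.

(** * Integrals of bounded functions supported in a ball *)

Section bounded_integral.
Context {R : realType} {d : nat}.
Notation mu := (@lebesgue_rV R d).
Variable D : set 'rV[R]_d.
Hypotheses (mD : measurable D) (Dfin : (mu D < +oo)%E).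

Lemma bounded_integrable (f : 'rV[R]_d -> R) (m : R) : measurable_fun D f ->
  (forall x, D x -> `|f x| <= m) -> mu.-integrable D (EFin \o f).
Proof.
move=> mf fm; apply: measurable_bounded_integrable => //.
exists m; split; first exact: num_real.
by move=> M mM x Dx; apply: le_trans (fm x Dx) (ltW mM).
Qed.

(** Comparison with m times the indicator of the closed sup-norm ball, a cube of volume (2 r)^d;
    cutting the cube by [D] can only lower its measure. *)
Lemma Rintegral_ball_le (f : 'rV[R]_d -> R) y (m r : R) : measurable_fun D f ->
  0 <= m -> 0 <= r -> (forall x, D x -> `|f x| <= m) ->
  (forall x, D x -> r < `|x - y| -> f x = 0) ->
  `|\int[mu]_(x in D) f x| <= m * (2 * r) ^+ d.
Proof.
move=> mf m0 r0 fm f0.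
pose A := [set x : 'rV[R]_d | `|x - y| <= r].
have mA : measurable A by exact: measurable_closed_ball_row.
have mA1 : measurable_fun D (\1_A : 'rV[R]_d -> R) by exact: measurable_indic.
have iA : mu.-integrable D (EFin \o (\1_A : 'rV[R]_d -> R)).
  apply: (@bounded_integrable _ 1) => // x _.
  by rewrite indicE; case: (_ \in _); rewrite ?normr1 ?normr0.
apply: le_trans (le_normr_Rintegral mD (bounded_integrable mf fm)) _.
apply: (@le_trans _ _ (\int[mu]_(x in D) (m * \1_A x))).
  apply: le_Rintegral => //.
  - apply: (@bounded_integrable _ m); first exact: measurableT_comp.
    by move=> x Dx; rewrite normr_id fm.
  - rewrite (_ : _ \o _ = EFin \o (fun x => m * \1_A x))//.
    apply: (@bounded_integrable _ m) => [|x _]; first exact: measurable_funM.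
    by rewrite normrM ger0_norm// ler_piMr// indicE; case: (_ \in _); rewrite ?normr1 ?normr0.
  - move=> x Dx; rewrite indicE; have [xA|xA] := boolP (x \in A).
      by rewrite mulr1 fm.
    rewrite f0 ?normr0 ?mulr0// ltNge; apply/negP => h.
    by move: xA; rewrite notin_setE; apply.
rewrite RintegralZl// ler_wpM2l// /Rintegral integral_indic//.
have := lebesgue_closed_ball_row y r0; rewrite -/A => Ar.
rewrite -[leRHS]/(fine ((2 * r) ^+ d)%:E) -Ar fine_le ?Ar//.
  rewrite ge0_fin_numE//; apply: le_lt_trans Dfin.
  by apply: le_measure; rewrite ?inE//; exact: measurableI.
rewrite -Ar; apply: le_measure; rewrite ?inE//; exact: measurableI.
Qed.

End bounded_integral.

(** By the mean value theorem C / al * t^al - e * f t does not decrease from s to r, for e = 1 and e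
    = -1. Bounding by the power of r alone makes the estimate uniform as s tends to 0. *)
Lemma derive_powR_bound {R : realType} (f df : R -> R) (C al s r : R) :
  0 < s <= r -> 0 < al -> 0 <= C ->
  (forall t, s <= t <= r -> is_derive t 1 f (df t)) ->
  (forall t, s <= t <= r -> `|df t| <= C * t `^ (al - 1)) ->
  `|f r - f s| <= C / al * r `^ al.
Proof.
move=> /andP[s0 sr] al0 C0 fdf dfC.
have key (e : R) : `|e| = 1 -> e * (f r - f s) <= C / al * r `^ al.
  move=> e1; pose g (t : R) := C / al * t `^ al - e * f t.
  have gd (t : R) : s <= t <= r -> is_derive t 1 g (C * t `^ (al - 1) - e * df t).
    move=> str; have /andP[st tr] := str; have t0 : 0 < t by exact: lt_le_trans st.
    have h1 := fdf t str; have h2 := is_derive1_powR al t0.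
    rewrite (_ : g = (C / al) *: (@powR R ^~ al) - e *: f)//.
    by apply: is_derive_eq; rewrite /GRing.scale/= mulrA divfK// gt_eqF.
  have [||t] := @MVT_segment _ g (fun t => C * t `^ (al - 1) - e * df t) s r sr.
  - by move=> t; rewrite in_itv/= => /andP[st tr]; apply: gd; rewrite !ltW.
  - apply: derivable_within_continuous => t; rewrite in_itv/= => h.
    by have [] := gd t h.
  rewrite in_itv/= => str E.
  have : 0 <= g r - g s.
    rewrite E mulr_ge0 ?subr_ge0//; apply: le_trans (dfC _ str).
    by apply: le_trans (ler_norm _) _; rewrite normrM e1 mul1r.
  rewrite /g => h.
  have : 0 <= C / al * s `^ al by rewrite mulr_ge0 ?powR_ge0// divr_ge0// ltW.
  lra.
rewrite ler_norml; apply/andP; split.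
  by have := key (-1); rewrite normrN normr1 => /(_ erefl); rewrite mulN1r lerNl.
by have := key 1; rewrite normr1 mul1r => /(_ erefl).
Qed.

(** * Weighted means and their derivative in the radius *)

Section weighted_mean.
Context {R : realType} {d : nat}.
Notation mu := (@lebesgue_rV R d).
Implicit Types (x y : 'rV[R]_d) (A B : 'M[R]_d).
Variables (D : set 'rV[R]_d) (v : 'rV[R]_d -> R) (U b k : R).
Hypotheses (mD : measurable D) (Dfin : (mu D < +oo)%E).
Hypotheses (mv : measurable_fun D v) (vU : forall x, D x -> `|v x| <= U).
Hypotheses (U0 : 0 <= U) (b0 : 0 <= b) (k0 : 0 <= k).

Let integrable_sub (f g : 'rV[R]_d -> R) : mu.-integrable D (EFin \o f) ->
  mu.-integrable D (EFin \o g) -> mu.-integrable D (EFin \o (fun x => f x - g x)).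
Proof. by move=> fi gi; exact: (integrableB mD fi gi). Qed.

Let integrable_scale (f : 'rV[R]_d -> R) c : mu.-integrable D (EFin \o f) ->
  mu.-integrable D (EFin \o (fun x => c * f x)).
Proof. by move=> fi; exact: (integrableZl mD c fi). Qed.

(** The integral of the squared paraboloid scales like t^(d + 4). The same exponent is the one for
    which the derivative in t becomes a multiple of the integrated trace formula. *)
Definition wmean B y (t : R) : R :=
  t^-1 ^+ (d + 4) * \int[mu]_(x in D) (v x * parab B y t x ^+ 2).

Lemma measurable_parab B y t n :
  measurable_fun D (fun x => parab B y t x ^+ n).
Proof.
apply: (@measurable_funX _ _ _ D (parab B y t)).
by apply: continuous_measurable_row; exact: cont_parab.
Qed.

Lemma measurable_hess B y t i j : B^T = B -> measurable_fun D (hess B y t i j).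
Proof.
move=> Bs; apply: continuous_measurable_row; rewrite -partial2_parab_cube//.
by have [_ _ /(_ i j)[]] := parab_cube_C2 y t Bs.
Qed.

Lemma integrable_parab B y t n : good b k B ->
  mu.-integrable D (EFin \o (fun x => v x * parab B y t x ^+ n)).
Proof.
move=> gB; apply: (@bounded_integrable _ _ _ mD Dfin _ (U * (t ^+ 2) ^+ n)).
  by apply: measurable_funM => //; exact: measurable_parab.
move=> x Dx; rewrite normrM; apply: ler_pM => //; first exact: vU.
rewrite normrX ger0_norm ?parab_ge0// lerXn2r ?nnegrE ?sqr_ge0 ?parab_ge0//.
exact: parab_le gB.
Qed.

(** The remainder of the pointwise expansion in t is quadratic uniformly in x, and [D] has finite
    measure. The exponent 1 is kept so that [integrable_parab] covers both integrals. *)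
Lemma is_derive_parab_integral B y (t : R) : good b k B ->
  is_derive t 1 (fun t : R => \int[mu]_(x in D) (v x * parab B y t x ^+ 2))
    (4 * t * \int[mu]_(x in D) (v x * parab B y t x ^+ 1)).
Proof.
move=> gB; pose V := fine (mu D).
have V0 : 0 <= V by apply: fine_ge0; exact: measure_ge0.
(* The first summand bounds the Taylor remainder for the increment (2 t + h) h of t^2 when |h| <= 1;
   the second bounds the term 2 w h^2 left over from the part h^2 of that increment. *)
pose m := U * ((2 * `|t| + 1) ^+ 2 + 2 * t ^+ 2).
have m0 : 0 <= m.
  by apply: mulr_ge0 => //; apply: addr_ge0; [exact: sqr_ge0|rewrite mulr_ge0 ?sqr_ge0].
apply: (@is_derive_quadratic _ _ _ _ _ _ (m * V)) => h h1.
rewrite /GRing.scale/= mulr1.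
pose f x := v x * (parab B y (h + t) x ^+ 2 - parab B y t x ^+ 2 - h * (4 * t) * parab B y t x).
have -> : \int[mu]_(x in D) (v x * parab B y (h + t) x ^+ 2) -
    \int[mu]_(x in D) (v x * parab B y t x ^+ 2) -
    h * (4 * t * \int[mu]_(x in D) (v x * parab B y t x ^+ 1)) =
    \int[mu]_(x in D) f x.
  rewrite mulrA -RintegralZl//; last exact: integrable_parab.
  have i1 := integrable_parab y (h + t) 2 gB.
  have i2 := integrable_parab y t 2 gB.
  rewrite -RintegralB// -RintegralB//.
  - by apply: eq_Rintegral => x _; rewrite /f; ring.
  - exact: integrable_sub.
  - by apply: integrable_scale; exact: integrable_parab.
have fm x : D x -> `|f x| <= m * h ^+ 2.
  move=> Dx; rewrite /f normrM.
  have -> : m * h ^+ 2 = U * (((2 * `|t| + 1) ^+ 2 + 2 * t ^+ 2) * h ^+ 2) by rewrite /m -(mulrA U).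
  apply: ler_pM => //; first exact: vU.
  have := max0_sqr_quadratic (t ^+ 2 - qf B (x - y)) (2 * t * h + h ^+ 2).
  rewrite (_ : t ^+ 2 - _ + _ = (h + t) ^+ 2 - qf B (x - y)); last by ring.
  rewrite -/(parab B y (h + t) x) -/(parab B y t x).
  set w := parab B y t x; set w' := parab _ _ _ _ => e1.
  have wt : `|w| <= t ^+ 2 by rewrite ger0_norm ?parab_ge0//; exact: parab_le gB.
  have -> : w' ^+ 2 - w ^+ 2 - h * (4 * t) * w =
    w' ^+ 2 - w ^+ 2 - 2 * w * (2 * t * h + h ^+ 2) + 2 * w * h ^+ 2 by ring.
  apply: le_trans (ler_normD _ _) _; rewrite [leRHS]mulrDl; apply: lerD.
    apply: le_trans e1 _; rewrite (_ : _ + _ = (2 * t + h) * h); last by ring.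
    rewrite exprMn ler_wpM2r ?sqr_ge0//.
    rewrite -[leLHS]real_normK ?num_real// lerXn2r ?nnegrE ?addr_ge0 ?mulr_ge0//.
    by apply: le_trans (ler_normD _ _) _; rewrite normrM ger0_norm// lerD2l.
  rewrite normrM [`|h ^+ 2|]ger0_norm ?sqr_ge0// ler_wpM2r ?sqr_ge0//.
  by rewrite normrM ger0_norm// ler_wpM2l.
have mf : measurable_fun D f.
  apply: measurable_funM => //; apply: measurable_funB.
    by apply: measurable_funB; exact: measurable_parab.
  by apply: measurable_funM => //; exact: (measurable_parab B y t 1).
apply: le_trans (le_normr_Rintegral mD (bounded_integrable mD Dfin mf fm)) _.
rewrite [leRHS](_ : _ = m * h ^+ 2 * V); last by ring.
rewrite -(Rintegral_cst mu mD); apply: le_Rintegral => //.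
  apply: (@bounded_integrable _ _ _ mD Dfin _ (m * h ^+ 2)); first exact: measurableT_comp.
  by move=> x Dx; rewrite normr_id fm.
apply: (@bounded_integrable _ _ _ mD Dfin (fun=> m * h ^+ 2) (m * h ^+ 2)) => // x _.
by rewrite ger0_norm// mulr_ge0 ?sqr_ge0.
Qed.

(** The product rule gives t^-(d + 5) (4 t^2 I1 - (d + 4) I2), where the bracket is one sixth of the
    integral of [trace_hess]. *)
Lemma is_derive_wmean A B y (t : R) : good b k B -> B *m A = 1%:M -> 0 < t ->
  is_derive t 1 (wmean B y)
   (t^-1 ^+ (d + 5) / 6 *
    \int[mu]_(x in D) (v x * \sum_i \sum_j A i j * hess B y t i j x)).
Proof.
move=> gB BA t0; have [Bs _ _] := gB.
have h1 := is_derive_parab_integral y t gB.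
set I1 := \int[mu]_(x in D) (v x * parab B y t x ^+ 1) in h1.
set I2 := \int[mu]_(x in D) (v x * parab B y t x ^+ 2).
have -> : \int[mu]_(x in D) (v x * \sum_i \sum_j A i j * hess B y t i j x) =
    24 * t ^+ 2 * I1 - (6 * d%:R + 24) * I2.
  rewrite -RintegralZl//; last exact: integrable_parab.
  rewrite -RintegralZl//; last exact: integrable_parab.
  rewrite -RintegralB//.
  - by apply: eq_Rintegral => x _; rewrite trace_hess//; ring.
  - by apply: integrable_scale; exact: integrable_parab.
  - by apply: integrable_scale; exact: integrable_parab.
have h2 : is_derive t 1 (fun s : R => s^-1) (- t ^- 2 *: 1).
  by apply: (@is_deriveV _ id); rewrite ?gt_eqF.
rewrite (_ : wmean B y = (fun s : R => s^-1) ^+ (d + 4) *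
  (fun t => \int[mu]_(x in D) (v x * parab B y t x ^+ 2))); last first.
  by apply/funext => s; rewrite /wmean exprfctE.
apply: is_derive_eq; rewrite -/I2 /GRing.scale/= !exprfctE.
have -> : (d + 4).-1 = (d + 3)%N by rewrite addnS.
rewrite natrD !exprD; set T := t^-1 ^+ d.
field. by rewrite gt_eqF.
Qed.

End weighted_mean.

(** * Frozen coefficients and the Lipschitz bound at a zero *)

Section zero_estimate.
Context {R : realType} {d : nat}.
Notation mu := (@lebesgue_rV R d).
Implicit Types (x y : 'rV[R]_d) (B : 'M[R]_d).
Variables (a : 'rV[R]_d -> 'M[R]_d) (u v : 'rV[R]_d -> R) (x0 : 'rV[R]_d).
Variables (N : set 'rV[R]_d) (rho M H lam al U k : R).

Let O : set 'rV[R]_d := [set x | `|x - x0| < rho].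
(** Off [N] the solution [v] and its representative [u] agree pointwise, so bounds and continuity of
    [u] become pointwise facts about [v] under the integral. *)
Let D := O `\` N.
Let b := d%:R / lam.

Hypotheses (rho0 : 0 < rho) (M0 : 0 <= M) (H0 : 0 <= H) (lam0 : 0 < lam).
Hypotheses (al01 : 0 < al < 1) (U0 : 0 <= U) (k1 : 1 <= k).
Hypothesis kM : (d%:R * M) ^+ 2 <= k ^+ 2 * lam.
Hypotheses (mN : measurable N) (muN : mu N = 0).
Hypotheses (mv : measurable_fun D v) (vu : forall x, D x -> v x = u x).
Hypothesis uU : forall x, O x -> `|u x| <= U.
Hypothesis ma : forall i j, measurable_fun D (fun x => a x i j).
Hypothesis aM : forall x i j, O x -> `|a x i j| <= M.
Hypothesis aH : forall x y i j, O x -> O y -> `|a x i j - a y i j| <= H * `|x - y| `^ al.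
Hypothesis asym : forall x, O x -> (a x)^T = a x.
Hypothesis aell : forall x z, O x -> lam * `|z| ^+ 2 <= qf (a x) z.
Hypothesis uc : forall y, O y -> forall e : R, 0 < e ->
  exists2 del : R, 0 < del & forall x, O x -> `|x - y| <= del -> `|u x - u y| <= e.
Hypothesis sol : forall B y (t : R), good b k B -> 0 < t -> `|y - x0| + k * t < rho ->
  \int[mu]_(x in D) (v x * \sum_i \sum_j a x i j * hess B y t i j x) = 0.

Let DO x : D x -> O x. Proof. by case. Qed.
Let k0 : 0 <= k. Proof. exact: le_trans k1. Qed.
Let b0 : 0 <= b. Proof. by rewrite divr_ge0// ltW. Qed.
Let al0 : 0 < al. Proof. by case/andP: al01. Qed.
Let mD : measurable D. Proof. by apply: measurableD => //; exact: measurable_ball_row. Qed.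
Let vU x : D x -> `|v x| <= U. Proof. by move=> Dx; rewrite vu// uU//; exact: DO. Qed.

Let Dfin : (mu D < +oo)%E.
Proof.
apply: (@le_lt_trans _ _ (mu [set x : 'rV[R]_d | `|x - x0| <= rho])).
  apply: le_measure; rewrite ?inE//; first exact: measurable_closed_ball_row.
  by move=> x [/ltW].
by rewrite lebesgue_closed_ball_row ?ltry// ltW.
Qed.

Let Bm y := invmx (a y).
(** The freezing point y' and the centre y are kept apart, because the means around two centres are
    compared with one and the same matrix. *)
Let P y' y t := wmean D v (Bm y') y t.

Let goodB y : O y -> good b k (Bm y).
Proof.
move=> Oy; apply: (good_invmx lam0 M0 (asym Oy) kM) => [z|i j]; first exact: aell.
exact: aM.
Qed.

Let unitB y : O y -> a y \in unitmx.
Proof. by move=> Oy; apply: (posdef_unitmx lam0) => z; exact: aell. Qed.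

Let Ox0 : O x0. Proof. by rewrite /O/= subrr normr0. Qed.

Let measurable_coef y' (h : 'I_d -> 'I_d -> 'rV[R]_d -> R) :
  (forall i j, measurable_fun D (h i j)) ->
  measurable_fun D (fun x => v x * \sum_i \sum_j (a y' i j - a x i j) * h i j x).
Proof.
move=> mh; apply: measurable_funM => //; apply: measurable_sum => i.
by apply: measurable_sum => j; apply: measurable_funM => //; exact: measurable_funB.
Qed.

(** The kernel [h] is left general: it will be a Hessian in one application and a difference of two
    Hessians in another. *)
Let coef_bound y' y (r S m e : R) (h : 'I_d -> 'I_d -> 'rV[R]_d -> R) :
  0 <= r -> 0 <= S -> 0 <= m -> 0 <= e ->
  (forall i j, measurable_fun D (h i j)) ->
  (forall x, D x -> `|x - y| <= r -> `|v x| <= S) ->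
  (forall x i j, D x -> `|x - y| <= r -> `|a y' i j - a x i j| <= m) ->
  (forall x i j, D x -> `|h i j x| <= e) ->
  (forall x i j, D x -> r < `|x - y| -> h i j x = 0) ->
  `|\int[mu]_(x in D) (v x * \sum_i \sum_j (a y' i j - a x i j) * h i j x)| <=
  S * (d%:R ^+ 2 * (m * e)) * (2 * r) ^+ d.
Proof.
move=> r0 S0 m0 e0 mh vS am he h0.
have h0' x : D x -> r < `|x - y| -> \sum_i \sum_j (a y' i j - a x i j) * h i j x = 0.
  move=> Dx rx; rewrite big1// => i _; rewrite big1// => j _.
  by rewrite h0// mulr0.
apply: (@Rintegral_ball_le _ _ _ mD Dfin _ y) => //; first exact: measurable_coef.
- by rewrite !mulr_ge0 ?sqr_ge0.
- move=> x Dx; have [rx|rx] := ltP r `|x - y|.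
    by rewrite h0'// mulr0 normr0 !mulr_ge0 ?sqr_ge0.
  rewrite normrM ler_pM ?vS//; apply: sum2_norm_le => i j.
  by rewrite normrM ler_pM ?am ?he.
- by move=> x Dx rx; rewrite h0'// mulr0.
Qed.

Let integrable_hess B y (t : R) (A : 'rV[R]_d -> 'M[R]_d) : good b k B -> 0 <= t ->
  (forall i j, measurable_fun D (fun x => A x i j)) ->
  (forall i j x, D x -> `|A x i j| <= M) ->
  mu.-integrable D (EFin \o (fun x => v x * \sum_i \sum_j A x i j * hess B y t i j x)).
Proof.
move=> gB t0 mA AM; have [Bs _ _] := gB; have [C C0 hC] := @hess_norm_le R d b k b0 k0.
apply: (@bounded_integrable _ _ _ mD Dfin _ (U * (d%:R ^+ 2 * (M * (C * t ^+ 4))))).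
  apply: measurable_funM => //; apply: measurable_sum => i.
  by apply: measurable_sum => j; apply: measurable_funM => //; exact: measurable_hess.
move=> x Dx; rewrite normrM ler_pM ?vU//; apply: sum2_norm_le => i j.
by rewrite normrM ler_pM ?AM ?hC.
Qed.

(** The integral given by the weak equation is 0 and is subtracted, which leaves the oscillation of
    [a] around its frozen value. The condition on y and t keeps the support of the test function
    inside [O]. *)
Let is_derive_P y' y (t : R) : O y' -> 0 < t -> `|y - x0| + k * t < rho ->
  is_derive t 1 (P y' y) (t^-1 ^+ (d + 5) / 6 * \int[mu]_(x in D)
    (v x * \sum_i \sum_j (a y' i j - a x i j) * hess (Bm y') y t i j x)).
Proof.
move=> Oy' t0 ytr; have gB := goodB Oy'; have [Bs _ _] := gB.
have h1 := is_derive_wmean mD Dfin mv vU U0 k0 y gB (mulVmx (unitB Oy')) t0.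
suff <- : \int[mu]_(x in D) (v x * \sum_i \sum_j a y' i j * hess (Bm y') y t i j x) =
    \int[mu]_(x in D)
      (v x * \sum_i \sum_j (a y' i j - a x i j) * hess (Bm y') y t i j x).
  exact: h1.
rewrite -[LHS]subr0 -[X in _ - X = _](sol gB t0 ytr) -RintegralB//.
- apply: eq_Rintegral => x _; rewrite -mulrBr -sumrB; congr (_ * _).
  apply: eq_bigr => i _; rewrite -sumrB; apply: eq_bigr => j _; by rewrite mulrBl.
- by apply: integrable_hess => //; [exact: ltW|move=> i j x _; exact: aM].
- by apply: integrable_hess => //; [exact: ltW|move=> i j x Dx; exact/aM/DO].
Qed.

Let scale_cancel (t c l : R) n : t != 0 ->
  t^-1 ^+ (d + n) * (c * t ^+ n * (l * t) ^+ d) = c * l ^+ d.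
Proof.
move=> t0; rewrite exprD exprMn.
transitivity (c * l ^+ d * (t^-1 ^+ d * t ^+ d) * (t^-1 ^+ n * t ^+ n)); first by ring.
by rewrite -!exprMn mulVf// !expr1n !mulr1.
Qed.

Let powR_le (x y : R) : 0 <= x <= y -> x `^ al <= y `^ al.
Proof.
move=> /andP[x_ge0 xy]; apply: ge0_ler_powR => //; first exact: ltW.
by rewrite nnegrE (le_trans x_ge0).
Qed.

(** On the support the coefficients oscillate by order t^al, the Hessian is of order t^4 and the
    volume of order t^d. Against t^-(d + 5) this leaves S t^(al - 1), which is integrable down to
    0. *)
Let frozen_mean_dist : exists2 C, 0 <= C & forall y (S r s : R),
  0 < s <= r -> `|y - x0| + k * r < rho -> 0 <= S ->
  (forall x, `|x - y| <= k * r -> `|u x| <= S) ->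
  `|P y y r - P y y s| <= C * S * r `^ al.
Proof.
have [C C0 hC] := @hess_norm_le R d b k b0 k0.
pose K := d%:R ^+ 2 * (H * k `^ al * C) * (2 * k) ^+ d / 6.
have K0 : 0 <= K.
  by rewrite /K divr_ge0// !mulr_ge0 ?sqr_ge0 ?powR_ge0 ?exprn_ge0// mulr_ge0.
exists (K / al) => [|y S r s sr yr S0 uS]; first by rewrite divr_ge0// ltW.
have /andP[s0 sler] := sr.
have Oy : O y by apply: le_lt_trans yr; rewrite lerDl mulr_ge0// (le_trans (ltW s0)).
have gB := goodB Oy; have [Bs _ _] := gB.
rewrite (_ : K / al * S * _ = (K * S) / al * r `^ al); last by ring.
have ty t : s <= t <= r -> 0 < t /\ `|y - x0| + k * t < rho.
  move=> /andP[st tr]; split; first exact: lt_le_trans st.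
  by apply: le_lt_trans yr; rewrite lerD2l ler_wpM2l.
apply: (derive_powR_bound sr al0) => [|t /ty[t0 yt]|t tsr]; first exact: mulr_ge0.
  exact: is_derive_P.
have [t0 yt] := ty t tsr; have /andP[st tr] := tsr.
have kt0 : 0 <= k * t by rewrite mulr_ge0// ltW.
have T0 : 0 <= t^-1 ^+ (d + 5) / 6 by rewrite divr_ge0// exprn_ge0// invr_ge0 ltW.
rewrite normrM (ger0_norm T0).
have := @coef_bound y y (k * t) S (H * (k * t) `^ al) (C * t ^+ 4) (hess (Bm y) y t) kt0 S0.
move=> /(_ (mulr_ge0 H0 (powR_ge0 _ _)) (mulr_ge0 C0 (exprn_ge0 _ (ltW t0)))) h.
apply: (@le_trans _ _ (t^-1 ^+ (d + 5) / 6 * (S * (d%:R ^+ 2 * (H * (k * t) `^ al * (C * t ^+ 4))) *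
      (2 * (k * t)) ^+ d))).
  rewrite ler_wpM2l//; apply: h.
  - by move=> i j; exact: measurable_hess.
  - move=> x Dx xy; rewrite vu// uS// (le_trans xy)// ler_wpM2l//.
  - move=> x i j Dx xy; rewrite (le_trans (aH _ _ Oy (DO Dx)))// ler_wpM2l// powR_le//.
    by rewrite normr_ge0/= distrC.
  - by move=> x i j Dx; rewrite hC// ltW.
  - by move=> x i j Dx xy; apply: (hess_supp k0 i j gB) => //; exact: ltW.
rewrite powRM ?(ltW t0)// [2 * (k * t)]mulrA.
(* Writing t^4 as t^5 / t lets [scale_cancel] remove every power of t except t^al / t. *)
rewrite [leLHS](_ : _ = (t^-1 ^+ (d + 5) *
   (S * d%:R ^+ 2 * (H * k `^ al * C) / 6 * (t `^ al / t) * t ^+ 5 * (2 * k * t) ^+ d))); last first.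
  by field; rewrite gt_eqF.
rewrite scale_cancel ?gt_eqF// -(mulr_powRB1 (ltW t0) al0).
rewrite [t * _ / t]mulrAC divff ?gt_eqF// mul1r /K.
by rewrite le_eqVlt; apply/orP; left; apply/eqP; ring.
Qed.

Let small_radius y (del : R) : O y -> 0 < del ->
  exists2 e : R, 0 < e & forall s, s <= e -> k * s <= del /\ `|y - x0| + k * s < rho.
Proof.
move=> Oy del0; have yr : 0 < rho - `|y - x0| by rewrite subr_gt0.
have kp : 0 < k by apply: lt_le_trans k1.
exists (Num.min del ((rho - `|y - x0|) / 2) / k).
  by rewrite divr_gt0// lt_min del0 divr_gt0.
move=> s; rewrite ler_pdivlMr// mulrC le_min => /andP[h1 h2]; split => //.
by rewrite -ltrBrDl (le_lt_trans h2)// ltr_pdivrMr// ltr_pMr// ltr1n.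
Qed.

Let measure_ball y (r : R) : 0 <= r -> `|y - x0| + r < rho ->
  \int[mu]_(x in D) (\1_[set x : 'rV[R]_d | `|x - y| <= r] x : R) = (2 * r) ^+ d.
Proof.
move=> r0 yr; set A := [set x | _].
have mA : measurable A by exact: measurable_closed_ball_row.
rewrite /Rintegral integral_indic// -[RHS]/(fine ((2 * r) ^+ d)%:E).
rewrite -(lebesgue_closed_ball_row y r0) -/A; congr fine.
have -> : A `&` D = A `\` N.
  apply/seteqP; split => x; first by move=> [Ax [_ Nx]].
  move=> [Ax Nx]; split => //; split => //; apply: le_lt_trans yr.
  by rewrite -(subrKA y) addrC (le_trans (ler_normD _ _))// lerD2l.
rewrite [RHS](measureDI mu mA mN) [X in (_ + X)%E](subset_measure0 _ _ _ muN) ?adde0//.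
exact: measurableI.
Qed.

(** [q] is the mean of the constant 1; its exact value is replaced by a lower bound independent of
    [y] and [s]. Continuity of [u] at [y] controls the rest. *)
Let frozen_mean_limit : exists2 c0, 0 < c0 & exists2 C, 0 <= C &
  forall y, O y -> forall e : R, 0 < e -> exists2 del : R, 0 < del &
  forall s, 0 < s <= del -> exists2 q, c0 <= q & `|P y y s - q * u y| <= C * e.
Proof.
(* Since d^2 b th^2 <= 1/2, within distance th s of the centre the form is at most s^2 / 2. There
   the squared paraboloid is at least s^4 / 4, on a cube of volume (2 th s)^d, whence the lower
   bound 4^-1 (2 th)^d. *)
pose th := (1 + 2 * (d%:R ^+ 2 * b))^-1.
have hb : 0 <= d%:R ^+ 2 * b by exact: mulr_ge0 (sqr_ge0 _) b0.
have th0 : 0 < th by rewrite /th invr_gt0; lra.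
have th1 : th <= 1 by rewrite /th invf_le1; lra.
have thb : d%:R ^+ 2 * b * th ^+ 2 <= 2^-1.
  apply: (@le_trans _ _ (d%:R ^+ 2 * b * th)).
    by rewrite ler_wpM2l// expr2 ler_piMl// ltW.
  by rewrite /th ler_pdivrMr; lra.
exists (4^-1 * (2 * th) ^+ d); first by rewrite mulr_gt0 ?invr_gt0 ?exprn_gt0 ?mulr_gt0.
exists ((2 * k) ^+ d) => [|y Oy e e0]; first by rewrite exprn_ge0 ?mulr_ge0.
have [del1 del10 h1] := uc Oy e0.
have [del del0 hdel] := small_radius Oy del10.
exists del => // s /andP[s0 /hdel[ks yks]].
have gB := goodB Oy; have [Bs Bb _] := gB.
have ks0 : 0 <= k * s by rewrite mulr_ge0// ltW.
have sN0 : s != 0 by rewrite gt_eqF.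
have T0 : 0 <= s^-1 ^+ (d + 4) by rewrite exprn_ge0// invr_ge0 ltW.
have i1 := integrable_parab mD Dfin mv vU k0 y s 2 gB.
have m2 : measurable_fun D (fun x => parab (Bm y) y s x ^+ 2) by exact: measurable_parab.
have w2 x : `|parab (Bm y) y s x ^+ 2| <= s ^+ 4.
  rewrite ger0_norm ?sqr_ge0// (_ : s ^+ 4 = (s ^+ 2) ^+ 2); last by ring.
  by rewrite lerXn2r ?nnegrE ?sqr_ge0 ?parab_ge0//; exact: parab_le gB.
have i2 : mu.-integrable D (EFin \o (fun x => parab (Bm y) y s x ^+ 2)).
  by apply: (bounded_integrable mD Dfin m2) => x _; exact: w2.
exists (s^-1 ^+ (d + 4) * \int[mu]_(x in D) parab (Bm y) y s x ^+ 2).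
  rewrite -(@scale_cancel s _ _ 4)// ler_wpM2l//.
  rewrite -(_ : (2 * (th * s)) ^+ d = (2 * th * s) ^+ d); last by rewrite mulrA.
  rewrite -(@measure_ball y (th * s)) ?mulr_ge0 ?(ltW th0) ?(ltW s0)//; last first.
    apply: le_lt_trans yks; rewrite lerD2l ler_wpM2r ?(ltW s0)//.
    exact: le_trans k1.
  set A := [set x | _].
  have mA : measurable A by exact: measurable_closed_ball_row.
  have mA1 : measurable_fun D (\1_A : 'rV[R]_d -> R) by exact: measurable_indic.
  have A1 x : `|\1_A x : R| <= 1.
    by rewrite indicE; case: (_ \in _); rewrite ?normr1 ?normr0.
  have iA : mu.-integrable D (EFin \o (\1_A : 'rV[R]_d -> R)).
    exact: (bounded_integrable mD Dfin mA1 (fun x _ => A1 x)).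
  rewrite -RintegralZl//; apply: le_Rintegral => //.
    apply: (@bounded_integrable _ _ _ mD Dfin _ (4^-1 * s ^+ 4)).
      exact: measurable_funM.
    move=> x _; rewrite normrM ger0_norm ?mulr_ge0 ?invr_ge0 ?exprn_ge0 ?(ltW s0)//.
    by rewrite ler_piMr ?mulr_ge0 ?invr_ge0 ?exprn_ge0 ?(ltW s0).
  move=> x _; rewrite indicE; have [xA|xA] := boolP (x \in A); last first.
    by rewrite mulr0 sqr_ge0.
  rewrite mulr1 (_ : 4^-1 * s ^+ 4 = (2^-1 * s ^+ 2) ^+ 2); last by field.
  rewrite lerXn2r ?nnegrE ?parab_ge0 ?mulr_ge0 ?invr_ge0 ?sqr_ge0 ?(ltW s0)//.
  rewrite /parab le_max; apply/orP; right.
  have := le_trans (ler_norm _) (qf_norm_le (x - y) b0 Bb).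
  have : d%:R ^+ 2 * b * `|x - y| ^+ 2 <= 2^-1 * s ^+ 2.
    apply: (@le_trans _ _ (d%:R ^+ 2 * b * (th * s) ^+ 2)).
      rewrite (ler_wpM2l hb)// lerXn2r ?nnegrE ?mulr_ge0 ?(ltW th0) ?(ltW s0)//.
      by move: xA; rewrite inE.
    by rewrite exprMn mulrA ler_wpM2r ?sqr_ge0.
  lra.
rewrite /P /wmean -mulrA -RintegralZr// -mulrBr -RintegralB//; last first.
  apply: (@bounded_integrable _ _ _ mD Dfin _ (s ^+ 4 * `|u y|)).
    exact: measurable_funM.
  by move=> x _; rewrite normrM ler_wpM2r// w2.
rewrite normrM (ger0_norm T0).
have -> : (2 * k) ^+ d * e = s^-1 ^+ (d + 4) * (e * s ^+ 4 * (2 * (k * s)) ^+ d).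
  by rewrite [2 * (k * s)]mulrA scale_cancel// mulrC.
rewrite ler_wpM2l//; under eq_Rintegral do rewrite [_ * u y]mulrC -mulrBl.
apply: (@Rintegral_ball_le _ _ _ mD Dfin _ y) => //.
- by apply: measurable_funM => //; exact: measurable_funB.
- by rewrite mulr_ge0 ?exprn_ge0 ?(ltW e0) ?(ltW s0).
- move=> x Dx; have [rx|rx] := ltP (k * s) `|x - y|.
    rewrite (parab_supp k0 gB (ltW s0) rx) expr0n mulr0 normr0.
    by rewrite mulr_ge0 ?exprn_ge0 ?(ltW e0) ?(ltW s0).
  by rewrite normrM ler_pM// vu// h1 ?(le_trans rx)//; exact: DO.
- by move=> x Dx rx; rewrite (parab_supp k0 gB (ltW s0) rx) expr0n mulr0.
Qed.

(** The comparison of two radii is uniform in the smaller one, which is sent to 0. The second clause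
    is for the centre [x0], whose own mean is then a mere error term. *)
Let frozen_mean_bound : exists2 c0, 0 < c0 & exists2 C, 0 <= C &
  forall y (S r : R), 0 < r -> `|y - x0| + k * r < rho -> 0 <= S ->
  (forall x, `|x - y| <= k * r -> `|u x| <= S) ->
  c0 * `|u y| <= `|P y y r| + C * S * r `^ al /\
  (u y = 0 -> `|P y y r| <= C * S * r `^ al).
Proof.
have [c0 c00 [Cq Cq0 hq]] := frozen_mean_limit; have [C C0 hC] := frozen_mean_dist.
exists c0 => //; exists C => // y S r r0 yr S0 uS.
have Oy : O y by apply: le_lt_trans yr; rewrite lerDl mulr_ge0// ltW.
have key e : 0 < e -> exists s q, [/\ c0 <= q, `|P y y s - q * u y| <= e &
    `|P y y r - P y y s| <= C * S * r `^ al].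
  move=> e0; have e1 : 0 < e / (Cq + 1) by rewrite divr_gt0// ltr_wpDl.
  have [del del0 hdel] := hq y Oy _ e1.
  have [|q qc qe] := hdel (Num.min del r); first by rewrite lt_min del0 r0 ge_min lexx.
  exists (Num.min del r), q; split => //.
    apply: le_trans qe _; rewrite mulrCA ler_piMr ?(ltW e0)//.
    by rewrite ler_pdivrMr ?ltr_wpDl// mul1r lerDl.
  by apply: hC => //; rewrite lt_min del0 r0 ge_min lexx orbT.
split => [|uy0]; apply/ler_addgt0Pr => e /key[s [q [qc h1 h2]]].
  apply: (@le_trans _ _ (q * `|u y|)); first by rewrite ler_wpM2r.
  have q0 : 0 <= q by apply: le_trans qc; exact: ltW.
  rewrite -[q]ger0_norm// -normrM.
  have -> : q * u y = P y y r - (P y y r - P y y s) - (P y y s - q * u y) by ring.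
  apply: le_trans (ler_normB _ _) _; rewrite lerD//.
  by apply: le_trans (ler_normB _ _) _; rewrite lerD2l.
rewrite uy0 mulr0 subr0 in h1.
rewrite -[P y y r](subrK (P y y s)); apply: le_trans (ler_normD _ _) _.
by rewrite lerD.
Qed.

Let integrable_coef y' (e : R) (h : 'I_d -> 'I_d -> 'rV[R]_d -> R) :
  O y' -> 0 <= e -> (forall i j, measurable_fun D (h i j)) ->
  (forall x i j, D x -> `|h i j x| <= e) ->
  mu.-integrable D (EFin \o
    (fun x => v x * \sum_i \sum_j (a y' i j - a x i j) * h i j x)).
Proof.
move=> Oy' e0 mh he.
apply: (@bounded_integrable _ _ _ mD Dfin _ (U * (d%:R ^+ 2 * ((M + M) * e)))).
  exact: measurable_coef.
move=> x Dx; rewrite normrM ler_pM ?vU//; apply: sum2_norm_le => i j.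
rewrite normrM ler_pM ?he//; apply: le_trans (ler_normB _ _) _.
by rewrite lerD ?aM//; exact: DO.
Qed.

(** With the matrix frozen at [x0] for both centres, the two derivatives share the factor a(x0) -
    a(x), and their difference involves only the difference of two Hessians. *)
Let center_dist : exists2 C, 0 <= C & forall y (G eps r s : R),
  0 < s <= r -> `|y - x0| <= s -> `|y - x0| + k * r < rho -> 0 <= G -> 0 <= eps ->
  (forall x, O x -> `|u x| <= G * (`|x - x0| + eps)) ->
  `|(P x0 y r - P x0 x0 r) - (P x0 y s - P x0 x0 s)| <=
    C * (G * (`|y - x0| + eps)) * r `^ al.
Proof.
have [Ch Ch0 hCh] := @hess_norm_le R d b k b0 k0.
have [C C0 hC] := @hess_dist R d b k b0 k0.
pose K := (k + 1) * (d%:R ^+ 2 * (H * (k + 1) `^ al * C) * (2 * (k + 1)) ^+ d / 6).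
have k10 : 0 <= k + 1 by rewrite addr_ge0.
have K0 : 0 <= K.
  rewrite /K mulr_ge0// divr_ge0// mulr_ge0 ?exprn_ge0 ?mulr_ge0//.
  by rewrite ?sqr_ge0 ?powR_ge0.
exists (K / al) => [|y G eps r s sr ys yr G0 eps0 uG]; first by rewrite divr_ge0// ltW.
have /andP[s0 sler] := sr.
have Oy : O y by apply: le_lt_trans yr; rewrite lerDl mulr_ge0// (le_trans (ltW s0)).
have gB := goodB Ox0; have [Bs _ _] := gB.
set q := `|y - x0|; have q0 : 0 <= q by exact: normr_ge0.
rewrite (_ : K / al * _ * _ = (K * (G * (q + eps))) / al * r `^ al); last by ring.
have ty t : s <= t <= r -> 0 < t /\ `|y - x0| + k * t < rho.
  move=> /andP[st tr]; split; first exact: lt_le_trans st.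
  by apply: le_lt_trans yr; rewrite lerD2l ler_wpM2l.
pose I y t := \int[mu]_(x in D)
    (v x * \sum_i \sum_j (a x0 i j - a x i j) * hess (Bm x0) y t i j x).
apply: (@derive_powR_bound R (fun t => P x0 y t - P x0 x0 t)
  (fun t => t^-1 ^+ (d + 5) / 6 * (I y t - I x0 t)) _ _ _ _ sr al0).
- by rewrite mulr_ge0// mulr_ge0// addr_ge0.
- move=> t /ty[t0 yt].
  have h1 := is_derive_P Ox0 t0 yt.
  have /(is_derive_P Ox0 t0) h2 : `|x0 - x0| + k * t < rho.
    by apply: le_lt_trans yt; rewrite subrr normr0 lerD2r.
  by rewrite mulrBr; exact: (is_deriveB h1 h2).
move=> t tsr; have [t0 yt] := ty t tsr; have /andP[st tr] := tsr.
have kt0 : 0 <= (k + 1) * t by rewrite mulr_ge0// ltW.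
have T0 : 0 <= t^-1 ^+ (d + 5) / 6 by rewrite divr_ge0// exprn_ge0// invr_ge0 ltW.
have qt : q <= t by exact: le_trans st.
rewrite normrM (ger0_norm T0).
pose h i j x := hess (Bm x0) y t i j x - hess (Bm x0) x0 t i j x.
have mh y' i j : measurable_fun D (hess (Bm x0) y' t i j) by exact: measurable_hess.
have -> : I y t - I x0 t = \int[mu]_(x in D)
    (v x * \sum_i \sum_j (a x0 i j - a x i j) * h i j x).
  have ih y' : mu.-integrable D (EFin \o (fun x => v x * \sum_i \sum_j
      (a x0 i j - a x i j) * hess (Bm x0) y' t i j x)).
    apply: (@integrable_coef _ (Ch * t ^+ 4)) => //.
      by rewrite mulr_ge0 ?exprn_ge0 ?(ltW t0).
    by move=> x i j _; apply: hCh => //; exact: ltW.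
  rewrite /I -RintegralB//; apply: eq_Rintegral => x _.
  rewrite -mulrBr -sumrB; congr (_ * _); apply: eq_bigr => i _.
  by rewrite -sumrB; apply: eq_bigr => j _; exact: esym (mulrBr _ _ _).
(* As q <= t, both supports lie in the ball of radius (k + 1) t about [x0], where |u| <= G ((k + 1)
   t + eps). *)
apply: (@le_trans _ _ (t^-1 ^+ (d + 5) / 6 * (G * ((k + 1) * t + eps) *
    (d%:R ^+ 2 * (H * ((k + 1) * t) `^ al * (C * t ^+ 3 * q))) *
      (2 * ((k + 1) * t)) ^+ d))).
  rewrite ler_wpM2l//; apply: (@coef_bound _ x0) => //.
  - by rewrite mulr_ge0// addr_ge0.
  - by rewrite mulr_ge0 ?powR_ge0.
  - by rewrite mulr_ge0// mulr_ge0// exprn_ge0// ltW.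
  - by move=> i j; apply: measurable_funB; exact: mh.
  - move=> x Dx xy; rewrite vu// (le_trans (uG _ (DO Dx)))// ler_wpM2l// lerD2r//.
  - move=> x i j Dx xy; rewrite (le_trans (aH _ _ Ox0 (DO Dx)))// ler_wpM2l// powR_le//.
    by rewrite normr_ge0/= distrC.
  - by move=> x i j Dx; apply: hC => //; exact: ltW.
  - move=> x i j Dx xy; rewrite /h.
    have xx0 : k * t < `|x - x0|.
      by apply: le_lt_trans xy; rewrite mulrDl lerDl mul1r ltW.
    have xy' : k * t < `|x - y|.
      rewrite -(ltrD2r q) (@lt_le_trans _ _ `|x - x0|)//.
        by apply: le_lt_trans xy; rewrite mulrDl mul1r lerD2l.
      by rewrite -(subrKA y) ler_normD.
    by rewrite !(hess_supp k0 i j gB (ltW t0))// subrr.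
(* From q <= t one has q ((k + 1) t + eps) <= t (k + 1) (q + eps): the power of t lost in the
   Hessian difference comes back. *)
apply: (@le_trans _ _ (t^-1 ^+ (d + 5) / 6 * (G * (t * ((k + 1) * (q + eps))) *
    (d%:R ^+ 2 * (H * ((k + 1) * t) `^ al * (C * t ^+ 3))) *
      (2 * ((k + 1) * t)) ^+ d))).
  rewrite ler_wpM2l//.
  have -> : G * ((k + 1) * t + eps) * (d%:R ^+ 2 * (H * ((k + 1) * t) `^ al * (C * t ^+ 3 * q))) =
    G * (q * ((k + 1) * t + eps)) * (d%:R ^+ 2 * (H * ((k + 1) * t) `^ al * (C * t ^+ 3))).
    by ring.
  have t3 : 0 <= t ^+ 3 by rewrite exprn_ge0// ltW.
  have l0 : 0 <= 2 * ((k + 1) * t) by rewrite mulr_ge0.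
  apply: ler_wpM2r; first exact: exprn_ge0.
  apply: ler_wpM2r.
    by apply: mulr_ge0; rewrite ?sqr_ge0//; apply: mulr_ge0; apply: mulr_ge0; rewrite ?powR_ge0.
  rewrite ler_wpM2l//.
  have h1 : q * eps <= t * eps by rewrite ler_wpM2r.
  have h2 : 0 <= k * (t * eps) by rewrite mulr_ge0// mulr_ge0// ltW.
  lra.
rewrite powRM ?(ltW t0)// [2 * ((k + 1) * t)]mulrA.
rewrite [leLHS](_ : _ = (t^-1 ^+ (d + 5) *
   (G * ((k + 1) * (q + eps)) * (d%:R ^+ 2 * (H * (k + 1) `^ al * C) / 6) *
      (t `^ al / t) * t ^+ 5 * (2 * (k + 1) * t) ^+ d))); last first.
  by field; rewrite gt_eqF.
rewrite scale_cancel ?gt_eqF// -(mulr_powRB1 (ltW t0) al0).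
rewrite [t * _ / t]mulrAC divff ?gt_eqF// mul1r /K.
by rewrite le_eqVlt; apply/orP; left; apply/eqP; ring.
Qed.

(** The constant deteriorates as r shrinks; the bound is applied at a single fixed radius only. *)
Let center_dist0 (r : R) : 0 < r -> exists2 C, 0 <= C & forall y, `|y - x0| <= r ->
  `|P x0 y r - P x0 x0 r| <= C * `|y - x0|.
Proof.
move=> r0; have [C C0 hC] := @parab2_dist R d b k b0 k0.
have T0 : 0 <= r^-1 ^+ (d + 4) by rewrite exprn_ge0// invr_ge0 ltW.
exists (r^-1 ^+ (d + 4) * (U * (C * r ^+ 3) * (2 * rho) ^+ d)) => [|y yr].
  by rewrite mulr_ge0// mulr_ge0 ?exprn_ge0 ?mulr_ge0 ?exprn_ge0//; exact: ltW.
have gB := goodB Ox0.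
have ii z := integrable_parab mD Dfin mv vU k0 z r 2 gB.
rewrite /P /wmean -mulrBr -RintegralB// normrM (ger0_norm T0).
rewrite [leRHS](_ : _ = r^-1 ^+ (d + 4) *
  (U * (C * r ^+ 3 * `|y - x0|) * (2 * rho) ^+ d)); last by ring.
rewrite ler_wpM2l//.
apply: (@Rintegral_ball_le _ _ _ mD Dfin _ x0).
- by apply: measurable_funB; apply: measurable_funM => //; exact: measurable_parab.
- by rewrite mulr_ge0// mulr_ge0// mulr_ge0// exprn_ge0// ltW.
- exact: ltW.
- move=> x Dx; rewrite -mulrBr normrM ler_pM ?vU//.
  by apply: hC => //; exact: ltW.
- by move=> x /DO/ltW; rewrite leNgt => /negP.
Qed.

(** Links the mean frozen at y, which detects u(y), to the one frozen at [x0], which can be compared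
    across centres. For t >= |y - x0| the inverse matrices differ by order t^al, so the switch costs
    no more than the freezing error. *)
Let matrix_dist : exists2 C, 0 <= C & forall y (S t : R),
  0 < t -> `|y - x0| <= t -> `|y - x0| + k * t < rho -> 0 <= S ->
  (forall x, `|x - y| <= k * t -> `|u x| <= S) ->
  `|P y y t - P x0 y t| <= C * S * t `^ al.
Proof.
have [C C0 hC] := @parab2_dist_mx R d b k k0.
pose K := C * (d%:R ^+ 2 * b ^+ 2 * H).
have K0 : 0 <= K by rewrite /K mulr_ge0// mulr_ge0// mulr_ge0 ?sqr_ge0.
exists (K * (2 * k) ^+ d) => [|y S t t0 yt ytr S0 uS].
  by rewrite mulr_ge0// exprn_ge0// mulr_ge0.
have Oy : O y by apply: le_lt_trans ytr; rewrite lerDl mulr_ge0// ltW.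
have gB := goodB Oy; have gB0 := goodB Ox0.
have T0 : 0 <= t^-1 ^+ (d + 4) by rewrite exprn_ge0// invr_ge0 ltW.
have i1 := integrable_parab mD Dfin mv vU k0 y t 2 gB.
have i2 := integrable_parab mD Dfin mv vU k0 y t 2 gB0.
rewrite /P /wmean -mulrBr -RintegralB// normrM (ger0_norm T0).
have -> : K * (2 * k) ^+ d * S * t `^ al =
    t^-1 ^+ (d + 4) * (S * (K * t `^ al) * t ^+ 4 * (2 * (k * t)) ^+ d).
  by rewrite [2 * (k * t)]mulrA scale_cancel ?gt_eqF//; ring.
have m0 : 0 <= S * (K * t `^ al) * t ^+ 4.
  by apply: mulr_ge0; [apply: mulr_ge0 => //; rewrite mulr_ge0 ?powR_ge0|rewrite exprn_ge0// ltW].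
rewrite ler_wpM2l//; apply: (@Rintegral_ball_le _ _ _ mD Dfin _ y) => //.
- by apply: measurable_funB; apply: measurable_funM => //; exact: measurable_parab.
- by rewrite mulr_ge0// ltW.
- move=> x Dx; have [rx|rx] := ltP (k * t) `|x - y|.
    rewrite (parab_supp k0 gB (ltW t0) rx) (parab_supp k0 gB0 (ltW t0) rx) subrr normr0.
    exact: m0.
  rewrite -mulrBr normrM -(mulrA S) ler_pM//; first by rewrite vu //; exact: uS.
  have BB i j : `|Bm y i j - Bm x0 i j| <= d%:R ^+ 2 * b ^+ 2 * (H * t `^ al).
    apply: invmx_dist => //; try exact: unitB.
    - by case: gB.
    - by case: gB0.
    - move=> i' j'; apply: le_trans (aH _ _ Oy Ox0) _; rewrite ler_wpM2l//.
      by rewrite powR_le// normr_ge0.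
  apply: le_trans (hC _ _ _ _ _ _ gB gB0 (ltW t0) BB _) _.
    by apply: mulr_ge0; apply: mulr_ge0; rewrite ?sqr_ge0 ?powR_ge0.
  by rewrite /K le_eqVlt; apply/orP; left; apply/eqP; ring.
- move=> x Dx rx.
  by rewrite (parab_supp k0 gB (ltW t0) rx) (parab_supp k0 gB0 (ltW t0) rx) subrr.
Qed.

Let small_powR (e : R) : 0 < e -> exists2 r, 0 < r & r `^ al <= e.
Proof.
move=> e0; exists (e `^ al^-1); first exact: powR_gt0.
by rewrite -powRrM mulVf ?gt_eqF// powRr1// ltW.
Qed.

Lemma zero_lipschitz : u x0 = 0 ->
  exists2 C, 0 <= C & forall y, O y -> `|u y| <= C * `|y - x0|.
Proof.
move=> ux0.
have [c0 c00 [C1 C10 h1]] := frozen_mean_bound.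
have [C2 C20 h2] := center_dist.
have [C3 C30 h3] := matrix_dist.
have k10 : 0 < k + 1 by rewrite ltr_wpDl.
(* Error budget: [frozen_mean_bound] enters twice, at y and at [x0], and [matrix_dist] once, each
   with S = (k + 1) G (q + eps); [center_dist] adds C2, and the final 1 makes L positive. *)
pose L := (2 * C1 + C3) * (k + 1) + C2 + 1.
have L0 : 0 < L.
  by rewrite /L ltr_wpDl// addr_ge0// mulr_ge0 ?(ltW k10)// addr_ge0// mulr_ge0.
have cL : 0 < c0 / 2 / L by rewrite !divr_gt0.
have [r1 r10 hr1] := small_powR cL.
(* The first bound makes the total error at most half of c0 G (q + eps); the second keeps all
   supports inside [O]. *)
pose r0 := Num.min r1 (rho / (2 * (k + 1))).
have r00 : 0 < r0 by rewrite /r0 lt_min r10 divr_gt0// mulr_gt0.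
have r0al : L * r0 `^ al <= c0 / 2.
  rewrite mulrC -ler_pdivlMr//; apply: le_trans hr1; apply: powR_le.
  by rewrite (ltW r00) /r0 ge_min lexx.
have r0rho : (k + 1) * r0 < rho.
  rewrite mulrC -ltr_pdivlMr// (@le_lt_trans _ _ (rho / (2 * (k + 1))))//.
    by rewrite /r0 ge_min lexx orbT.
  by rewrite ltr_pM2l// ltf_pV2 ?posrE ?mulr_gt0// ltr_pMl// ltr1n.
have [C4 C40 h4] := center_dist0 r00.
(* C4 / c0 comes from comparing the centres at radius r0; U / r0 makes the claim trivial for points
   farther than r0 from [x0]. *)
pose C5 := C4 / c0 + U / r0.
have C50 : 0 <= C5 by rewrite /C5 addr_ge0// divr_ge0// ltW.
have step (G eps : R) : 0 <= G -> 0 < eps ->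
    (forall y, O y -> `|u y| <= G * (`|y - x0| + eps)) ->
    forall y, O y -> `|u y| <= C5 * `|y - x0| + 2^-1 * (G * (`|y - x0| + eps)).
  move=> G0 eps0 uG y Oy; set q := `|y - x0|.
  have q0 : 0 <= q by exact: normr_ge0.
  have Gq0 : 0 <= G * (q + eps) by rewrite mulr_ge0// addr_ge0// ltW.
  have [r0q|qr0] := ltP r0 q.
    apply: le_trans (uU Oy) _.
    have : U <= U / r0 * q by rewrite mulrAC ler_pdivlMr// ler_wpM2l// ltW.
    have : 0 <= C4 / c0 * q by rewrite mulr_ge0// divr_ge0// ltW.
    by rewrite /C5; lra.
  have [qz|qn0] := eqVneq q 0.
    have /eqP : `|y - x0| = 0 by [].
    rewrite normr_eq0 subr_eq0 => /eqP ->; rewrite ux0 normr0.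
    by apply: addr_ge0; exact: mulr_ge0.
  have qp : 0 < q by rewrite lt_neqAle eq_sym qn0.
  have kq r : 0 <= r <= r0 -> q <= r0 -> q + k * r < rho.
    move=> /andP[r_ge0 rr0] _; apply: le_lt_trans r0rho.
    by rewrite mulrDl mul1r addrC lerD// ler_wpM2l.
  have qq : q + k * q < rho by apply: kq => //; rewrite q0.
  have qr : q + k * r0 < rho by apply: kq => //; rewrite lexx (ltW r00).
  pose S := G * ((k + 1) * (q + eps)).
  have S0 : 0 <= S by rewrite /S mulr_ge0// mulr_ge0 ?(ltW k10)// addr_ge0// ltW.
  have uS x : `|x - x0| <= (k + 1) * q -> `|u x| <= S.
    move=> xq; have Ox : O x.
      apply: le_lt_trans r0rho; apply: le_trans xq _.
      by rewrite ler_wpM2l// ltW.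
    apply: le_trans (uG x Ox) _; rewrite /S ler_wpM2l// mulrDr lerD//.
    by rewrite ler_peMl ?(ltW eps0)// lerDr.
  have uSy x : `|x - y| <= k * q -> `|u x| <= S.
    move=> xq; apply: uS; rewrite mulrDl mul1r -(subrKA y).
    by apply: le_trans (ler_normD _ _) _; rewrite lerD2r.
  have uSx x : `|x - x0| <= k * q -> `|u x| <= S.
    move=> xq; apply: uS; apply: le_trans xq _.
    by rewrite ler_wpM2r// lerDl.
  have [e1 _] := h1 y S q qp qq S0 uSy.
  have xq : `|x0 - x0| + k * q < rho.
    by apply: le_lt_trans qq; rewrite subrr normr0 lerD2r.
  have [_ /(_ ux0) e2] := h1 x0 S q qp xq S0 uSx.
  have e3 := h3 y S q qp (lexx _) qq S0 uSy.
  have qr' : 0 < q <= r0 by rewrite qp.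
  have e4 := h2 y G eps r0 q qr' (lexx _) qr G0 (ltW eps0) uG.
  have e5 := h4 y qr0.
  rewrite -/q in e4 e5.
  have q_al : S * q `^ al <= S * r0 `^ al by rewrite ler_wpM2l// powR_le// q0.
  (* The path starting at the mean around y at radius q: switch the matrix, compare the centres at
     r0, transport that comparison from r0 down to q, and end at the mean around [x0], which is
     small because [u] vanishes there. *)
  have tele (p1 p2 p3 p4 p5 : R) : `|p1| <= `|p1 - p2| +
      (`|p3 - p4| + `|p3 - p4 - (p2 - p5)| + `|p5|).
    rewrite [X in `|X| <= _](_ : _ = (p1 - p2) +
      ((p3 - p4) - (p3 - p4 - (p2 - p5)) + p5)); last by ring.
    rewrite (le_trans (ler_normD _ _))// lerD2l.
    rewrite (le_trans (ler_normD _ _))// lerD2r.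
    exact: ler_normB.
  have e6 := tele (P y y q) (P x0 y q) (P x0 y r0) (P x0 x0 r0) (P x0 x0 q).
  have main : c0 * `|u y| <= C4 * q + (G * (q + eps)) * (L * r0 `^ al).
    have t1 : C1 * S * q `^ al <= C1 * S * r0 `^ al by rewrite -2!(mulrA C1) ler_wpM2l.
    have t3 : C3 * S * q `^ al <= C3 * S * r0 `^ al by rewrite -2!(mulrA C3) ler_wpM2l.
    have t4 : 0 <= G * (q + eps) * r0 `^ al by rewrite mulr_ge0// powR_ge0.
    have -> : (G * (q + eps)) * (L * r0 `^ al) = 2 * (C1 * S * r0 `^ al) +
      C3 * S * r0 `^ al + C2 * (G * (q + eps)) * r0 `^ al + G * (q + eps) * r0 `^ al.
      by rewrite /L /S; ring.
    move: e1 e2 e3 e4 e5 e6 t1 t3 t4.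
    move: (P y y q) (P x0 y q) (P x0 y r0) (P x0 x0 r0) (P x0 x0 q) => p1 p2 p3 p4 p5.
    move: (q `^ al) (r0 `^ al) => qa ra.
    lra.
  have main2 : c0 * `|u y| <= C4 * q + (G * (q + eps)) * (c0 / 2).
    by apply: le_trans main _; rewrite lerD2l ler_wpM2l.
  rewrite -(ler_pM2l c00); apply: le_trans main2 _.
  have -> : c0 * (C5 * q + 2^-1 * (G * (q + eps))) =
     C4 * q + G * (q + eps) * (c0 / 2) + c0 * (U / r0 * q).
    by rewrite /C5; field; rewrite !gt_eqF.
  by rewrite lerDl mulr_ge0 ?(ltW c00)// mulr_ge0// divr_ge0// ltW.
exists (2 * C5) => [|y Oy]; first by rewrite mulr_ge0.
suff main_eps (eps : R) : 0 < eps -> `|u y| <= 2 * C5 * (`|y - x0| + eps).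
  have C5p : 0 < 2 * C5 + 1 by rewrite ltr_wpDl// mulr_ge0.
  apply/ler_addgt0Pr => e e0; apply: le_trans (main_eps (e / (2 * C5 + 1)) _) _.
    by rewrite divr_gt0.
  rewrite mulrDr lerD2l mulrCA ler_piMr ?(ltW e0)//.
  by rewrite ler_pdivrMr// mul1r lerDl.
move=> eps0.
(* The quotients are bounded by U / eps. As their supremum is finite, [step] gives sup Q <= C5 + sup
   Q / 2, hence a bound free of eps. *)
pose Q := [set `|u x| / (`|x - x0| + eps) | x in O].
have pe x : 0 < `|x - x0| + eps by rewrite ltr_wpDl.
have Q0 : Q !=set0 by exists (`|u x0| / (`|x0 - x0| + eps)); exists x0.
have QU : has_ubound Q.
  exists (U / eps) => _ [x Ox <-]; rewrite ler_pM ?invr_ge0 ?uU//; first exact: ltW.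
  by rewrite lef_pV2 ?posrE// lerDr.
have QG x : O x -> `|u x| <= sup Q * (`|x - x0| + eps).
  move=> Ox; rewrite -ler_pdivrMr//; apply: ub_le_sup => //.
  by exists x.
have G0 : 0 <= sup Q.
  have := QG x0 Ox0; rewrite ux0 normr0 => h.
  by rewrite -(pmulr_lge0 _ (pe x0)).
have hs := step _ _ G0 eps0 QG.
suff sG : sup Q <= 2 * C5 by apply: le_trans (QG y Oy) _; rewrite ler_wpM2r// ltW.
have : sup Q <= C5 + 2^-1 * sup Q; last by lra.
apply: ge_sup => // _ [x Ox <-]; rewrite ler_pdivrMr//.
apply: le_trans (hs x Ox) _; rewrite [leRHS]mulrDl -[_ * sup Q * _]mulrA lerD2r.
by rewrite ler_wpM2l// lerDl ltW.
Qed.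

End zero_estimate.

(** * Comparison of the Euclidean norm with the sup norm *)

Section enorm_norm.
Context {R : realType} {d : nat}.
Implicit Types (x y : 'rV[R]_d).

Lemma enorm_sqr x : enorm x ^+ 2 = dotr x x.
Proof.
rewrite /enorm sqr_sqrtr; last by apply: sumr_ge0 => i _; rewrite sqr_ge0.
by apply: eq_bigr => i _; rewrite expr2.
Qed.

Lemma enorm_ge0 x : 0 <= enorm x.
Proof. exact: sqrtr_ge0. Qed.

Lemma norm_le_enorm x : `|x| <= enorm x.
Proof.
by rewrite -(@ler_pXn2r _ 2) ?nnegrE ?enorm_ge0// enorm_sqr dotr_norm_ge.
Qed.

Lemma enorm_le_norm x : enorm x <= (d%:R + 1) * `|x|.
Proof.
have d0 : (0 : R) <= d%:R by [].
rewrite -(@ler_pXn2r _ 2) ?nnegrE ?enorm_ge0 ?mulr_ge0 ?addr_ge0// enorm_sqr.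
apply: le_trans (ler_norm _) (le_trans (dotr_norm_le _ _) _).
rewrite -expr2 exprMn ler_wpM2r ?sqr_ge0//; nra.
Qed.

Lemma open_B1 : open (@B1 R d).
Proof.
have cs : continuous (fun x : 'rV[R]_d => dotr x x).
  apply: continuous_big; first exact: add_continuous.
  by move=> i _ x; apply: continuousM; exact: (@coord_continuous R _ _ ord0 i).
rewrite (_ : B1 = (fun x : 'rV[R]_d => dotr x x) @^-1` [set s | s < 1]).
  by move/continuousP: cs; apply; exact: open_lt.
apply/seteqP; split => x; rewrite /B1 /eball/= subr0 -enorm_sqr => h.
  by rewrite -(expr1n _ 2) ltr_pXn2r ?nnegrE ?enorm_ge0.
by rewrite -(@ltr_pXn2r _ 2) ?nnegrE ?enorm_ge0// expr1n.
Qed.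

Lemma compact_closed_ball_row y (r : R) : compact [set x : 'rV[R]_d | `|x - y| <= r].
Proof.
apply: bounded_closed_compact; last exact: closed_closed_ball_row.
exists (r + `|y|); split; first exact: num_real.
move=> M hM x /= xy; apply: le_trans (ltW hM).
by rewrite -(subrK y x) (le_trans (ler_normD _ _))// lerD2r.
Qed.

End enorm_norm.

(** * From the weak formulation to the local hypotheses *)

Section zero_of_solution.
Context {R : realType} {d : nat}.
Notation mu := (@lebesgue_rV R d).
Implicit Types (x y : 'rV[R]_d).

Lemma holder_loc_ball (a : 'rV[R]_d -> 'M[R]_d) (al rho : R) x0 : 0 <= al ->
  (forall i j, holder_loc al B1 (fun x => a x i j)) ->
  [set x : 'rV[R]_d | `|x - x0| <= rho] `<=` B1 ->
  exists2 H, 0 <= H & forall x y i j, `|x - x0| <= rho -> `|y - x0| <= rho ->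
    `|a x i j - a y i j| <= H * `|x - y| `^ al.
Proof.
move=> al0 ah KB.
have h (p : 'I_d * 'I_d) : exists C, forall x y, `|x - x0| <= rho -> `|y - x0| <= rho ->
    `|a x p.1 p.2 - a y p.1 p.2| <= C * enorm (x - y) `^ al.
  have [C hC] := ah p.1 p.2 _ (@compact_closed_ball_row R d x0 rho) KB.
  by exists C => x y xr yr; exact: hC.
have [C hC] := choice h.
have d1 : (0 : R) <= d%:R + 1 by rewrite addr_ge0.
(* The constants of [holder_loc] carry no sign and depend on the entry, so their absolute values are
   summed; (d + 1)^al pays for passing from [enorm] to the sup norm. *)
exists ((\sum_p `|C p|) * (d%:R + 1) `^ al) => [|x y i j xr yr].
  by rewrite mulr_ge0 ?powR_ge0// sumr_ge0.
apply: le_trans (hC (i, j) x y xr yr) _; rewrite -mulrA -powRM//.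
apply: (@le_trans _ _ (`|C (i, j)| * enorm (x - y) `^ al)).
  by rewrite ler_wpM2r ?powR_ge0// ler_norm.
apply: ler_pM => //; first exact: powR_ge0.
  by rewrite (bigD1 (i, j))//= lerDl sumr_ge0.
apply: ge0_ler_powR; rewrite ?nnegrE ?enorm_ge0 ?mulr_ge0//.
exact: enorm_le_norm.
Qed.

Lemma holder_continuous (f : 'rV[R]_d -> R) (al H rho : R) x0 : 0 < al -> 0 <= H ->
  (forall x y, `|x - x0| <= rho -> `|y - x0| <= rho -> `|f x - f y| <= H * `|x - y| `^ al) ->
  forall x, `|x - x0| < rho -> {for x, continuous f}.
Proof.
move=> al0 H0 fH x xr.
suff : f z @[z --> x] --> f x by [].
apply/(@cvgrPdist_le _ R _ (nbhs x)) => e e0.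
have e1 : 0 < (e / (H + 1)) `^ al^-1 by rewrite powR_gt0// divr_gt0// ltr_wpDl.
have r1 : 0 < rho - `|x - x0| by rewrite subr_gt0.
have near_x (c : R) : 0 < c -> \forall y \near x, `|x - y| < c.
  by move=> c0; apply/nbhs_ballP; exists c => // y; rewrite -ball_normE.
near=> y.
have yx : `|x - y| < (e / (H + 1)) `^ al^-1.
  by near: y; exact: near_x.
have yr : `|x - y| < rho - `|x - x0|.
  by near: y; exact: near_x.
apply: le_trans (fH _ _ (ltW xr) _) _.
  rewrite -(subrKA x) addrC (le_trans (ler_normD _ _))//.
  by rewrite [`|y - x|]distrC; lra.
apply: (@le_trans _ _ (H * (e / (H + 1)))).
  rewrite ler_wpM2l// (@le_trans _ _ (((e / (H + 1)) `^ al^-1) `^ al))//.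
    by apply: ge0_ler_powR; rewrite ?nnegrE ?powR_ge0// ltW.
  by rewrite -powRrM mulVf ?gt_eqF// powRr1// divr_ge0 ?addr_ge0// ltW.
by rewrite mulrCA ler_piMr ?(ltW e0)// ler_pdivrMr ?ltr_wpDl// mul1r lerDl.
Unshelve. all: by end_near. Qed.

(* The integrand is supported in the small ball, and [v] may be replaced by [u]
   away from the null set [N]. *)
Lemma weak_solution_hess (a : 'rV[R]_d -> 'M[R]_d) (v : 'rV[R]_d -> R)
    (O N : set 'rV[R]_d) B y (b k t : R) :
  weak_solution a v -> O `<=` B1 -> measurable O -> measurable N -> mu N = 0 ->
  measurable_fun O v -> (forall i j, measurable_fun O (fun x => a x i j)) ->
  0 <= k -> good b k B -> 0 < t -> [set x : 'rV[R]_d | `|x - y| <= k * t] `<=` O ->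
  \int[mu]_(x in O `\` N) (v x * \sum_i \sum_j a x i j * hess B y t i j x) = 0.
Proof.
move=> sol OB mO mN muN mv ma k0 gB t0 KO; have [Bs _ _] := gB.
have := sol (fun x => parab B y t x ^+ 3); set K := [set x | _] in KO.
have phi : C2_c B1 (fun x => parab B y t x ^+ 3).
  split; first exact: parab_cube_C2.
  exists K; split; first exact: compact_closed_ball_row.
    exact: subset_trans OB.
  move=> x /negP; rewrite -ltNge => xy.
  by rewrite (parab_supp k0 gB (ltW t0) xy) expr0n.
move=> /(_ phi) E.
pose F x := v x * \sum_i \sum_j a x i j * hess B y t i j x.
have FE x : \sum_i \sum_j a x i j * v x *
    partial j (partial i (fun x => parab B y t x ^+ 3)) x = F x.
  rewrite /F mulr_sumr; apply: eq_bigr => i _; rewrite mulr_sumr; apply: eq_bigr => j _.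
  by rewrite partial2_parab_cube// mulrCA mulrA.
have F0 x : ~ O x -> F x = 0.
  move=> nOx; rewrite /F big1 ?mulr0// => i _; rewrite big1// => j _.
  rewrite (hess_supp k0 i j gB (ltW t0)) ?mulr0// ltNge; apply/negP => xK.
  exact/nOx/KO.
have mF : measurable_fun O F.
  apply: measurable_funM => //; apply: measurable_sum => i.
  apply: measurable_sum => j; apply: measurable_funM => //; exact: measurable_hess.
rewrite -/(F _) /Rintegral; suff -> : (\int[mu]_(x in O `\` N) (F x)%:E = 0)%E by [].
rewrite -[RHS]E; under [RHS]eq_integral do rewrite FE.
have -> : (\int[mu]_(x in B1) (F x)%:E = \int[mu]_(x in O) (F x)%:E)%E.
  rewrite integral_mkcond [RHS]integral_mkcond; congr integral; apply/funext => x.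
  rewrite !patchE; case: ifPn => xB; case: ifPn => xO //.
    by rewrite F0//; move: xO; rewrite notin_setE.
  by move: xB; rewrite notin_setE => xB; exfalso; apply: xB; apply: OB; rewrite inE in xO.
rewrite setDE integral_mkcondr; apply: ae_eq_integral => //.
- apply/(measurable_restrict _ _ _) => //; first exact: measurableC.
  by apply: (measurable_funS mO) => //; exact/measurable_EFinP.
- exact/measurable_EFinP.
- exists N; split => // x /= /not_implyP [Ox]; rewrite patchE.
  by case: ifPn => //; rewrite notin_setE/= => /contrapT.
Qed.

End zero_of_solution.

(** Localization to a ball inside [B1] on which |u| <= 1; such a ball exists because [u] is
    continuous and vanishes at [x0]. *)
Lemma weak_solution_zero_lipschitz (R : realType) (d : nat)
    (a : 'rV[R]_d -> 'M[R]_d) (lam Lam alpha : R)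
    (a_sym : forall x, B1 x -> (a x)^T = a x)
    (lam0 : 0 < lam)
    (a_ell : forall x, B1 x -> elliptic lam Lam (a x))
    (alpha01 : 0 < alpha < 1)
    (a_holder : forall i j, holder_loc alpha B1 (fun x => a x i j))
    (v u : 'rV[R]_d -> R)
    (v_meas : measurable_fun B1 v)
    (v_sol : weak_solution a v)
    (u_cont : {within B1, continuous u})
    (u_rep : {ae @lebesgue_rV R d, forall x, B1 x -> v x = u x})
    (x0 : 'rV[R]_d) (x0S : S0 u x0) :
  exists2 C : R, 0 <= C & exists2 rho : R, 0 < rho &
    forall x, `|x - x0| < rho -> `|u x| <= C * `|x - x0|.
Proof.
have [Bx0 ux0] := x0S; have /andP[al0 al1] := alpha01.
have uc1 y : B1 y -> {for y, continuous u}.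
  move: u_cont; rewrite continuous_open_subspace; last exact: open_B1.
  by move=> h By; apply: h; rewrite inE.
have uc y : B1 y -> forall e : R, 0 < e ->
    exists2 del : R, 0 < del & forall x, `|x - y| <= del -> `|u x - u y| <= e.
  move=> By e e0; have : nbhs y [set x | `|u x - u y| <= e].
    apply: (uc1 y By [set s | `|s - u y| <= e]); apply/nbhs_ballP; exists e => // s.
    by rewrite -ball_normE/= distrC => /ltW.
  move=> /nbhs_ballP[del /= del0 hdel]; exists (del / 2); first by rewrite divr_gt0.
  move=> x xy; apply: hdel; rewrite -ball_normE/= distrC (le_lt_trans xy)//.
  by rewrite ltr_pdivrMr// ltr_pMr// ltr1n.
have [rho [rho0 KB u1]] : exists rho : R, [/\ 0 < rho,
    [set x : 'rV[R]_d | `|x - x0| <= rho] `<=` B1 &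
    forall x, `|x - x0| < rho -> `|u x| <= 1].
  have /nbhs_ballP[e /= e0 eB] := open_nbhs_nbhs (conj (@open_B1 R d) Bx0).
  have [del del0 hdel] := uc x0 Bx0 1 ltr01.
  exists (Num.min (e / 2) del); split; first by rewrite lt_min del0 divr_gt0.
    move=> x /=; rewrite le_min => /andP[xe _]; apply: eB.
    rewrite -ball_normE/= distrC (le_lt_trans xe)//.
    by rewrite ltr_pdivrMr// ltr_pMr// ltr1n.
  move=> x; rewrite lt_min => /andP[_ /ltW/hdel].
  by rewrite ux0 subr0.
have [H H0 aH] := holder_loc_ball (ltW al0) a_holder KB.
pose O := [set x : 'rV[R]_d | `|x - x0| < rho].
have OB : O `<=` B1 by move=> x /ltW; exact: KB.
have mO : measurable O by exact: measurable_ball_row.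
have mB : measurable (@B1 R d) by apply: measurable_open_row; exact: open_B1.
have ma i j : measurable_fun O (fun x => a x i j).
  apply: open_continuous_measurable.
    rewrite (_ : O = ball x0 rho); first exact: ball_open.
    by apply/seteqP; split => x; rewrite -ball_normE/= distrC.
  by apply: (@holder_continuous _ _ _ alpha H) => // x y xr yr; exact: aH.
have mvO : measurable_fun O v by exact: (measurable_funS mB OB).
have [N [mN muN hN]] := u_rep.
(* The entries at [x0] plus their Hoelder variation over the ball. *)
pose M := (\sum_i \sum_j `|a x0 i j|) + H * rho `^ alpha.
have M0 : 0 <= M.
  by rewrite /M addr_ge0 ?mulr_ge0 ?powR_ge0// sumr_ge0// => i _; rewrite sumr_ge0.
have aM x i j : O x -> `|a x i j| <= M.
  move=> Ox; rewrite -(subrK (a x0 i j) (a x i j)) addrC.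
  apply: le_trans (ler_normD _ _) _; rewrite /M lerD//.
    rewrite (bigD1 i)//= (bigD1 j)//= -addrA lerDl addr_ge0 ?sumr_ge0// => l _.
    by rewrite sumr_ge0.
  apply: le_trans (aH _ _ _ _ (ltW Ox) _) _; first by rewrite subrr normr0 ltW.
  rewrite ler_wpM2l//; apply: ge0_ler_powR; rewrite ?nnegrE ?(ltW al0) ?(ltW rho0)//.
  exact: ltW.
(* Chosen so that k sqrt(lam) >= d M, the condition of [good_invmx]; the summand 1 gives k >= 1. *)
pose k := 1 + d%:R * M / Num.sqrt lam.
have sl0 : 0 < Num.sqrt lam by rewrite sqrtr_gt0.
have dM0 : 0 <= d%:R * M / Num.sqrt lam by rewrite divr_ge0 ?mulr_ge0// ltW.
have k1 : 1 <= k by rewrite lerDl.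
have kM : (d%:R * M) ^+ 2 <= k ^+ 2 * lam.
  rewrite -[X in _ <= _ * X](sqr_sqrtr (ltW lam0)) -exprMn.
  rewrite lerXn2r ?nnegrE ?mulr_ge0 ?(ltW sl0) ?(le_trans ler01 k1)//.
  by rewrite -ler_pdivrMr// lerDr.
have k0 : 0 <= k by exact: le_trans k1.
have aell x z : O x -> lam * `|z| ^+ 2 <= qf (a x) z.
  move=> /OB/a_ell/(_ z)/andP[+ _]; rewrite -qfE; apply: le_trans.
  by rewrite ler_wpM2l ?(ltW lam0)// lerXn2r ?nnegrE ?enorm_ge0 ?norm_le_enorm.
have DO : O `\` N `<=` O by move=> x [].
have vu x : (O `\` N) x -> v x = u x.
  by move=> [Ox Nx]; apply: contrapT => vux; apply: Nx; apply: hN => /(_ (OB _ Ox)).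
have ucO y : O y -> forall e : R, 0 < e ->
    exists2 del : R, 0 < del & forall x, O x -> `|x - y| <= del -> `|u x - u y| <= e.
  by move=> Oy e /(uc y (OB _ Oy))[del del0 hdel]; exists del => // x _; exact: hdel.
have solO (B : 'M[R]_d) y (t : R) : good (d%:R / lam) k B -> 0 < t ->
    `|y - x0| + k * t < rho -> \int[@lebesgue_rV R d]_(x in O `\` N)
      (v x * \sum_i \sum_j a x i j * hess B y t i j x) = 0.
  move=> gB t0 yt.
  apply: (weak_solution_hess v_sol OB mO mN muN mvO ma k0 gB t0) => x /= xy.
  apply: le_lt_trans yt; rewrite -(subrKA y) addrC.
  by rewrite (le_trans (ler_normD _ _))// lerD2l.
have [C C0 hC] := zero_lipschitz rho0 M0 H0 lam0 alpha01 ler01 k1 kM mN muN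
  (measurable_funS mO DO mvO) vu u1 (fun i j => measurable_funS mO DO (ma i j)) aM
  (fun x y i j Ox Oy => aH x y i j (ltW Ox) (ltW Oy))
  (fun x Ox => a_sym x (OB _ Ox)) aell ucO solO ux0.
by exists C => //; exists rho.
Qed.

Unset Implicit Arguments.

Theorem theorem1 (R : realType) (d : nat) (hd : (1 <= d)%N)
    (a : 'rV[R]_d -> 'M[R]_d) (lam Lam alpha : R)
    (a_sym : forall x, B1 x -> (a x)^T = a x)
    (lamLam : 0 < lam <= Lam)
    (a_ell : forall x, B1 x -> elliptic lam Lam (a x))
    (alpha01 : 0 < alpha < 1)
    (a_holder : forall i j, holder_loc alpha B1 (fun x => a x i j))
    (* v is the L^1_loc solution, u its continuous representative *)
    (v u : 'rV[R]_d -> R)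
    (v_L1 : L1_loc B1 v)
    (v_sol : weak_solution a v)
    (u_cont : {within B1, continuous u})
    (u_rep : {ae @lebesgue_rV R d, forall x, B1 x -> v x = u x})
    (x0 : 'rV[R]_d) (x0S : S0 u x0) :
  C1minus_at u x0 /\
  exists C : R, 0 < C /\ exists r0 : R, 0 < r0 /\
    forall r : R, 0 < r < r0 ->
      forall alphas : R, 0 < alphas < 1 ->
        (osc_at u x0 r <= (C * r `^ alphas)%:E)%E.
Proof.
suff [C [C0 [r0 [r00 h]]]] : exists C : R, 0 < C /\ exists r0 : R, 0 < r0 /\
    forall r : R, 0 < r < r0 -> forall alphas : R, 0 < alphas < 1 ->
        (osc_at u x0 r <= (C * r `^ alphas)%:E)%E.
  split; last by exists C; split => //; exists r0.
  move=> al al01; exists C; split => //; exists r0; split => // r rr.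
  exact: h.
have /andP[lam0 _] := lamLam.
have [C C0 [rho rho0 hC]] := weak_solution_zero_lipschitz a_sym lam0 a_ell alpha01
  a_holder v_L1.1 v_sol u_cont u_rep x0S.
exists (C + 1); split; first by rewrite ltr_wpDl.
(* For r < 1 one has r <= r^al for every al in (0,1), so the Lipschitz bound serves all exponents
   with one constant and one radius. *)
exists (Num.min 1 rho); split; first by rewrite lt_min ltr01.
move=> r /andP[r0]; rewrite lt_min => /andP[r1 rrho] al /andP[al0 al1].
apply: ub_ereal_sup => _ [y yr <-]; rewrite lee_fin x0S.2 sub0r normrN.
have yx : `|y - x0| < r by apply: le_lt_trans yr; exact: norm_le_enorm.
apply: le_trans (hC y (lt_trans yx rrho)) _.
apply: ler_pM => //; first by rewrite lerDl.
apply: (@le_trans _ _ (r `^ 1)); first by rewrite powRr1 ?ltW.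
by apply: ger_powR; rewrite ?r0 ?ltW.
Qed.
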